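(* Let $K$ be a field of characteristic $0$, $n\ge 2$, $P_0=K[x_1,\dots,x_n]$, $P=P_0[y_1,\dots,y_n]$ bigraded by $\deg x_i=(1,0)$, $\deg y_i=(0,1)$, and $P_+=(y_1,\dots,y_n)$. Let $r\ge 1$ be an integer and, for $\lambda\in K^n$, let $f_\lambda=\sum_{i=1}^n\lambda_i x_iy_i$. Then there exists a nonempty Zariski open subset $V\subset K^n$ such that for all $\lambda\in V$ and all $j\le -n$, $$\operatorname{reg} H^{n-1}_{P_+}(P/f_\lambda^rP)_j=-n-j+r+1 .$$
   Context: For a bigraded $P$-module $N$, $N_j=\bigoplus_i N_{(i,j)}$ is a graded $P_0$-module with $(N_j)_i=N_{(i,j)}$. $H^{n-1}_{P_+}$ is local cohomology with its natural bigrading; its components in fixed $y$-degree $j$ are finitely generated graded $P_0$-modules. $\operatorname{reg}$ denotes Castelnuovo-Mumford regularity over $P_0$: $\operatorname{reg} N=\max_{i,k}\{a_{ik}-i\}$ if $N\neq 0$ has minimal graded free resolution with $i$-th module $\bigoplus_kP_0(-a_{ik})$. *)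

(* Defs.v *)
From HB Require Import structures.
From mathcomp Require Import all_boot all_order all_algebra.
From mathcomp Require Import generic_quotient ring_quotient.
From mathcomp Require Import ring.
From mathcomp Require Import boolp classical_sets mpoly.

Set Implicit Arguments.
Unset Strict Implicit.
Unset Printing Implicit Defensive.

Import Order.TTheory GRing.Theory Num.Theory.

Local Open Scope classical_set_scope.
Local Open Scope quotient_scope.
Local Open Scope ring_scope.

Section QuotientModule.
Variables (R : comNzRingType) (A : lmodType R) (S : submodClosed A).

(* submodClosed bundles closure under 0, + and scaling only, as it also serves
   semimodules; quot wants closure under opposite as well. *)
Definition submod_zmod : {pred A} := S.

Fact submod_zmod_closed : zmod_closed submod_zmod.
Proof.
split=> [|u v]; first exact: rpred0.
by move=> uS vS; apply: rpredD => //; rewrite -scaleN1r; apply: rpredZ.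
Qed.

HB.instance Definition _ := GRing.isZmodClosed.Build A submod_zmod
  submod_zmod_closed.

Definition quot_mod : Type := Quotient.quot submod_zmod.
Local Notation Q := quot_mod.

HB.instance Definition _ := GRing.Zmodule.on Q.

Definition quot_pi (u : A) : Q := \pi_(Quotient.quot submod_zmod) u.
Definition quot_repr (u : Q) : A := repr (u : Quotient.quot submod_zmod).

Lemma quot_reprK u : quot_pi (quot_repr u) = u.
Proof. exact: reprK. Qed.

Lemma quot_piE u v : (quot_pi u = quot_pi v) <-> (u - v \in S).
Proof.
by split=> [/eqP|uv]; [|apply/eqP]; rewrite /quot_pi -Quotient.idealrBE.
Qed.

Lemma quot_piD : {morph quot_pi : u v / u + v}.
Proof. by move=> u v; rewrite /quot_pi Quotient.pi_add. Qed.

Definition quot_scale (a : R) (u : Q) : Q := quot_pi (a *: quot_repr u).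

Lemma quot_scale_pi a u : quot_scale a (quot_pi u) = quot_pi (a *: u).
Proof. by apply/quot_piE; rewrite -scalerBr rpredZ //; apply/quot_piE/quot_reprK. Qed.

Fact quot_scaleA a b u : quot_scale a (quot_scale b u) = quot_scale (a * b) u.
Proof. by rewrite -[u]quot_reprK !quot_scale_pi scalerA. Qed.

Fact quot_scale1 : left_id 1 quot_scale.
Proof. by move=> u; rewrite -[u]quot_reprK quot_scale_pi scale1r. Qed.

Fact quot_scaleDr : right_distributive quot_scale +%R.
Proof.
move=> a u v; rewrite -[u]quot_reprK -[v]quot_reprK -quot_piD !quot_scale_pi.
by rewrite scalerDr quot_piD.
Qed.

Fact quot_scaleDl u : {morph quot_scale^~ u : a b / a + b}.
Proof.
by move=> a b; rewrite -[u]quot_reprK !quot_scale_pi scalerDl quot_piD.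
Qed.

HB.instance Definition _ := GRing.Zmodule_isLmodule.Build R Q
  quot_scaleA quot_scale1 quot_scaleDr quot_scaleDl.

Fact quot_pi_is_linear : linear quot_pi.
Proof. by move=> a u v; rewrite quot_piD -quot_scale_pi. Qed.

HB.instance Definition _ := GRing.isLinear.Build R A Q _ quot_pi
  quot_pi_is_linear.

End QuotientModule.

Section Submodules.
Variable R : comNzRingType.

Section Cyclic.
Variables (A : lmodType R) (u : A).

Definition cyclic_sub : {pred A} := fun v => `[< exists a : R, v = a *: u >].

Fact cyclic_sub_closed : submod_closed cyclic_sub.
Proof.
split=> [|a v w]; first by apply/asboolP; exists 0; rewrite scale0r.
move=> /asboolP [b ->] /asboolP [c ->]; apply/asboolP; exists (a * b + c).
by rewrite scalerDl scalerA.
Qed.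

HB.instance Definition _ := GRing.isSubmodClosed.Build R A cyclic_sub
  cyclic_sub_closed.
End Cyclic.

Section Image.
Variables (A B : lmodType R) (f : {linear A -> B}).

Definition im_sub : {pred B} := fun v => `[< exists u : A, v = f u >].

Fact im_sub_closed : submod_closed im_sub.
Proof.
split=> [|a v w]; first by apply/asboolP; exists 0; rewrite linear0.
move=> /asboolP [b ->] /asboolP [c ->]; apply/asboolP; exists (a *: b + c).
by rewrite linearP.
Qed.

HB.instance Definition _ := GRing.isSubmodClosed.Build R B im_sub im_sub_closed.
End Image.
End Submodules.

Definition restrict_scalars (R0 R : comNzRingType) (f : {rmorphism R0 -> R})
  (A : lmodType R) : Type := A.

Section RestrictScalars.
Variables (R0 R : comNzRingType) (f : {rmorphism R0 -> R}) (A : lmodType R).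
Local Notation A0 := (restrict_scalars f A).

HB.instance Definition _ := GRing.Zmodule.on A0.

Definition restrict_scale (a : R0) (u : A0) : A0 := f a *: (u : A).

Fact restrict_scaleA a b u :
  restrict_scale a (restrict_scale b u) = restrict_scale (a * b) u.
Proof. by rewrite /restrict_scale scalerA rmorphM. Qed.

Fact restrict_scale1 : left_id 1 restrict_scale.
Proof. by move=> u; rewrite /restrict_scale rmorph1 scale1r. Qed.

Fact restrict_scaleDr : right_distributive restrict_scale +%R.
Proof. by move=> a u v; rewrite /restrict_scale scalerDr. Qed.

Fact restrict_scaleDl u : {morph restrict_scale^~ u : a b / a + b}.
Proof. by move=> a b; rewrite /restrict_scale rmorphD scalerDl. Qed.

HB.instance Definition _ := GRing.Zmodule_isLmodule.Build R0 A0
  restrict_scaleA restrict_scale1 restrict_scaleDr restrict_scaleDl.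

End RestrictScalars.

Section DependentProduct.
Variables (R : comNzRingType) (I : Type) (A : I -> lmodType R).

Definition dprodm : Type := forall i, A i.

HB.instance Definition _ := gen_eqMixin dprodm.
HB.instance Definition _ := gen_choiceMixin dprodm.

Definition dprodm_zero : dprodm := fun i => 0.
Definition dprodm_opp (u : dprodm) : dprodm := fun i => - u i.
Definition dprodm_add (u v : dprodm) : dprodm := fun i => u i + v i.
Definition dprodm_scale (a : R) (u : dprodm) : dprodm := fun i => a *: u i.

Fact dprodm_addA : associative dprodm_add.
Proof. by move=> u v w; apply: functional_extensionality_dep => i; apply: addrA. Qed.
Fact dprodm_addC : commutative dprodm_add.
Proof. by move=> u v; apply: functional_extensionality_dep => i; apply: addrC. Qed.
Fact dprodm_add0 : left_id dprodm_zero dprodm_add.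
Proof. by move=> u; apply: functional_extensionality_dep => i; apply: add0r. Qed.
Fact dprodm_addN : left_inverse dprodm_zero dprodm_opp dprodm_add.
Proof. by move=> u; apply: functional_extensionality_dep => i; apply: addNr. Qed.

HB.instance Definition _ := GRing.isZmodule.Build dprodm
  dprodm_addA dprodm_addC dprodm_add0 dprodm_addN.

Fact dprodm_scaleA a b u :
  dprodm_scale a (dprodm_scale b u) = dprodm_scale (a * b) u.
Proof. by apply: functional_extensionality_dep => i; apply: scalerA. Qed.
Fact dprodm_scale1 : left_id 1 dprodm_scale.
Proof. by move=> u; apply: functional_extensionality_dep => i; apply: scale1r. Qed.
Fact dprodm_scaleDr : right_distributive dprodm_scale +%R.
Proof. by move=> a u v; apply: functional_extensionality_dep => i; apply: scalerDr. Qed.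
Fact dprodm_scaleDl u : {morph dprodm_scale^~ u : a b / a + b}.
Proof. by move=> a b; apply: functional_extensionality_dep => i; apply: scalerDl. Qed.

HB.instance Definition _ := GRing.Zmodule_isLmodule.Build R dprodm
  dprodm_scaleA dprodm_scale1 dprodm_scaleDr dprodm_scaleDl.

End DependentProduct.

(* The localization A_s, as classes of fractions u / s^k coded by pairs (u, k). *)
Section Localization.
Variables (R : comNzRingType) (A : lmodType R) (s : R).

Definition loc_rel (x y : A * nat) : bool :=
  `[< exists t : nat,
        s ^+ t *: (s ^+ y.2 *: x.1) = s ^+ t *: (s ^+ x.2 *: y.1) >].

Fact loc_rel_equiv : equiv_class_of loc_rel.
Proof.
split=> [x|x y|y x z]; first by apply/asboolP; exists 0%N.
  by apply/asboolP/asboolP => -[t e]; exists t.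
move=> /asboolP [t e] /asboolP [t' e']; apply/asboolP.
exists (t + t' + y.2)%N.
have -> : s ^+ (t + t' + y.2) *: (s ^+ z.2 *: x.1)
        = s ^+ (t' + z.2) *: (s ^+ t *: (s ^+ y.2 *: x.1)).
  by rewrite !scalerA -!exprD; congr (s ^+ _ *: _); ring.
rewrite e.
have -> : s ^+ (t + t' + y.2) *: (s ^+ x.2 *: z.1)
        = s ^+ (t + x.2) *: (s ^+ t' *: (s ^+ y.2 *: z.1)).
  by rewrite !scalerA -!exprD; congr (s ^+ _ *: _); ring.
by rewrite -e' !scalerA -!exprD; congr (s ^+ _ *: _); ring.
Qed.

Canonical loc_rel_equivRel := EquivRelPack loc_rel_equiv.

Definition locm : Type := {eq_quot loc_rel}.

HB.instance Definition _ := Choice.on locm.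

Definition frac (u : A) (k : nat) : locm := \pi_({eq_quot loc_rel}) (u, k).
Definition frac_num (x : locm) : A := (repr (x : {eq_quot loc_rel})).1.
Definition frac_exp (x : locm) : nat := (repr (x : {eq_quot loc_rel})).2.

Lemma fracK x : frac (frac_num x) (frac_exp x) = x.
Proof. by rewrite /frac /frac_num /frac_exp -surjective_pairing; apply: reprK. Qed.

Lemma fracP u k v l : frac u k = frac v l <->
  exists t : nat, s ^+ t *: (s ^+ l *: u) = s ^+ t *: (s ^+ k *: v).
Proof.
split=> [/eqmodP/asboolP //|h]; apply/eqmodP; exact/asboolP.
Qed.

Lemma frac_eq u k v l : s ^+ l *: u = s ^+ k *: v -> frac u k = frac v l.
Proof. by move=> e; apply/fracP; exists 0%N; rewrite e. Qed.

Definition locm_zero : locm := frac 0 0.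
Definition locm_opp (x : locm) : locm := frac (- frac_num x) (frac_exp x).
Definition locm_add (x y : locm) : locm :=
  frac (s ^+ frac_exp y *: frac_num x + s ^+ frac_exp x *: frac_num y)
       (frac_exp x + frac_exp y).
Definition locm_scale (a : R) (x : locm) : locm :=
  frac (a *: frac_num x) (frac_exp x).

Lemma locm_oppE u k : locm_opp (frac u k) = frac (- u) k.
Proof.
have /fracP [t e] := fracK (frac u k); apply/fracP; exists t.
by rewrite !scalerN e.
Qed.

Lemma locm_scaleE a u k : locm_scale a (frac u k) = frac (a *: u) k.
Proof.
have /fracP [t e] := fracK (frac u k); apply/fracP; exists t.
have sw m (w : A) : s ^+ t *: (s ^+ m *: (a *: w))
                  = a *: (s ^+ t *: (s ^+ m *: w)).
  by rewrite !scalerA; congr (_ *: _); ring.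
by rewrite !sw e.
Qed.

Lemma locm_addE u k v l :
  locm_add (frac u k) (frac v l) = frac (s ^+ l *: u + s ^+ k *: v) (k + l).
Proof.
have /fracP [t e] := fracK (frac u k); have /fracP [t' e'] := fracK (frac v l).
set u' := frac_num _ in e *; set k' := frac_exp _ in e *.
set v' := frac_num (frac v l) in e' *; set l' := frac_exp (frac v l) in e' *.
apply/fracP; exists (t + t')%N; rewrite !scalerDr; congr (_ + _).
  have -> : s ^+ (t + t') *: (s ^+ (k + l) *: (s ^+ l' *: u'))
     = s ^+ (t' + l + l') *: (s ^+ t *: (s ^+ k *: u')).
    by rewrite !scalerA; congr (_ *: _); rewrite -!exprD; congr (_ ^+ _); ring.
  rewrite e !scalerA; congr (_ *: _); rewrite -!exprD; congr (_ ^+ _); ring.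
have -> : s ^+ (t + t') *: (s ^+ (k + l) *: (s ^+ k' *: v'))
   = s ^+ (t + k + k') *: (s ^+ t' *: (s ^+ l *: v')).
  by rewrite !scalerA; congr (_ *: _); rewrite -!exprD; congr (_ ^+ _); ring.
rewrite e' !scalerA; congr (_ *: _); rewrite -!exprD; congr (_ ^+ _); ring.
Qed.

Fact locm_addA : associative locm_add.
Proof.
move=> x y z; rewrite -[x]fracK -[y]fracK -[z]fracK.
move: (frac_num x) (frac_exp x) (frac_num y) (frac_exp y) (frac_num z)
  (frac_exp z) => u k v l w m.
rewrite !locm_addE addnA !scalerDr !scalerA -!exprD addrA.
by rewrite (addnC m l) (addnC m k).
Qed.

Fact locm_addC : commutative locm_add.
Proof. by move=> x y; rewrite /locm_add addrC addnC. Qed.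

Fact locm_add0 : left_id locm_zero locm_add.
Proof. by move=> x; rewrite -[x]fracK locm_addE scaler0 add0r scale1r. Qed.

Fact locm_addN : left_inverse locm_zero locm_opp locm_add.
Proof.
move=> x; rewrite -[x]fracK locm_oppE locm_addE; apply: frac_eq.
by rewrite !scalerN addNr !scaler0.
Qed.

HB.instance Definition _ := GRing.isZmodule.Build locm
  locm_addA locm_addC locm_add0 locm_addN.

Fact locm_scaleA a b x : locm_scale a (locm_scale b x) = locm_scale (a * b) x.
Proof. by rewrite -[x]fracK !locm_scaleE scalerA. Qed.

Fact locm_scale1 : left_id 1 locm_scale.
Proof. by move=> x; rewrite -[x]fracK locm_scaleE scale1r. Qed.

Fact locm_scaleDr : right_distributive locm_scale +%R.
Proof.
move=> a x y; rewrite -[x]fracK -[y]fracK -[LHS]/(locm_scale a (locm_add _ _)).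
rewrite -[RHS]/(locm_add _ _) !(locm_addE, locm_scaleE); congr frac.
by rewrite scalerDr !scalerA ![a * _]mulrC.
Qed.

Fact locm_scaleDl x : {morph locm_scale^~ x : a b / a + b}.
Proof.
move=> a b; rewrite -[x]fracK; move: (frac_num x) (frac_exp x) => u k.
rewrite -[RHS]/(locm_add _ _) !(locm_addE, locm_scaleE).
by apply: frac_eq; rewrite -scalerDr -scalerDl !scalerA -!exprD.
Qed.

HB.instance Definition _ := GRing.Zmodule_isLmodule.Build R locm
  locm_scaleA locm_scale1 locm_scaleDr locm_scaleDl.

Lemma fracD u k v l : frac u k + frac v l = frac (s ^+ l *: u + s ^+ k *: v) (k + l).
Proof. exact: locm_addE. Qed.

Lemma fracZ a u k : a *: frac u k = frac (a *: u) k.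
Proof. exact: locm_scaleE. Qed.

End Localization.

(* The canonical map A_s -> A_s' for s' = s * t, that is u / s^k |-> t^k u / s'^k. *)
Section LocalizationMap.
Variables (R : comNzRingType) (A : lmodType R) (s t s' : R).
Hypothesis s'E : s' = s * t.

Definition locm_map (x : locm A s) : locm A s' :=
  frac s' (t ^+ frac_exp x *: frac_num x) (frac_exp x).

Lemma locm_mapE u k : locm_map (frac s u k) = frac s' (t ^+ k *: u) k.
Proof.
have /fracP [m e] := fracK (frac s u k); apply/fracP; exists m.
set u' := frac_num _ in e *; set k' := frac_exp _ in e *.
have sw p q (w : A) : s' ^+ m *: (s' ^+ p *: (t ^+ q *: w))
                    = t ^+ (m + p + q) *: (s ^+ m *: (s ^+ p *: w)).
  by rewrite s'E !exprMn !exprD !scalerA; congr (_ *: _); ring.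
rewrite !sw e; congr (_ ^+ _ *: _); ring.
Qed.

Fact locm_map_is_linear : linear locm_map.
Proof.
move=> a x y; rewrite -[x]fracK -[y]fracK.
move: (frac_num x) (frac_exp x) (frac_num y) (frac_exp y) => u k v l.
rewrite fracZ fracD !locm_mapE fracZ fracD.
by congr (frac _ _ _); rewrite s'E !exprMn !scalerDr !exprD !scalerA;
   congr (_ *: _ + _ *: _); ring.
Qed.

End LocalizationMap.

(* The Cech complex of A with respect to y_1, ..., y_n, as one module: the
   product of all localizations A_(y_I), y_I = \prod_(i in I) y_i. Its part of
   cohomological degree p consists of the families supported on #|I| = p. *)
Section Cech.
Variables (R : comNzRingType) (n : nat) (y : 'I_n -> R) (A : lmodType R).

Definition cech : Type := dprodm (fun I : {set 'I_n} => locm A (\prod_(i in I) y i)).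
HB.instance Definition _ := GRing.Lmodule.on cech.

Definition cech_deg (p : nat) : set cech :=
  [set c | forall I : {set 'I_n}, #|I| <> p -> c I = 0].

Definition cech_d (c : cech) : cech := fun J =>
  \sum_(i in J) (-1) ^+ #|[set k in J | (k < i)%N]| *:
    locm_map (y i) (\prod_(k in J) y k) (c (J :\ i)%SET).

Fact cech_d_is_linear : linear cech_d.
Proof.
move=> a c c'; apply: functional_extensionality_dep => J.
rewrite -[RHS]/(a *: cech_d c J + cech_d c' J) /cech_d scaler_sumr -big_split.
apply: eq_bigr => i iJ /=; rewrite -[X in locm_map _ _ X]/(a *: c _ + c' _).
rewrite locm_map_is_linear; last by rewrite (big_setD1 i) //= mulrC.
by rewrite scalerDr !scalerA mulrC.
Qed.

HB.instance Definition _ := GRing.isLinear.Build R cech cech _ cech_d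
  cech_d_is_linear.

End Cech.

(* A module with a family of homogeneous components. The graded module meant is
   the internal direct sum of the components: elements of the carrier outside
   that sum play no role. *)
Record bigraded (R : comNzRingType) := Bigraded {
  bg_mod :> lmodType R;
  bg_comp : int -> int -> set bg_mod }.

Record graded (R : comNzRingType) := Graded {
  gr_mod :> lmodType R;
  gr_comp : int -> set gr_mod }.

Section LocalCohomology.
Variables (K : fieldType) (n : nat).

Local Notation P0 := {mpoly K[n]}.
Local Notation P := {mpoly {mpoly K[n]}[n]}.

Definition P0_comp (d : int) : set P0 :=
  [set p | forall m, m \in msupp p -> (mdeg m)%:Z = d].

Definition P_comp (i j : int) : set P :=
  [set p | forall m, m \in msupp p -> (mdeg m)%:Z = j /\ P0_comp i p@_m].

Definition cyclic_quotient (f : P) : bigraded P :=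
  @Bigraded _ (quot_mod (cyclic_sub (f : P^o)))
    (fun i j => [set @quot_pi _ _ (cyclic_sub (f : P^o)) p | p in P_comp i j]).

Definition locm_comp (M : bigraded P) (I : {set 'I_n}) (i j : int) :
    set (locm M (\prod_(k in I) 'X_k)) :=
  [set x | exists k u, bg_comp i (j + (k * #|I|)%:Z) u /\ x = frac _ u k].

(* H^p with support in (y_1, ..., y_n): the classes of the cocycles of degree p
   modulo all coboundaries. *)
Definition local_cohomology (p : nat) (M : bigraded P) : bigraded P :=
  @Bigraded _ (quot_mod (im_sub (@cech_d P n (fun k => 'X_k) M)))
    (fun i j => [set h | exists c : cech (fun k : 'I_n => 'X_k : P) M,
       [/\ cech_deg p c, cech_d c = 0, forall I, locm_comp i j (c I)
         & h = quot_pi _ c]]).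

Definition y_comp (M : bigraded P) (j : int) : graded P0 :=
  @Graded _ (restrict_scalars (@mpolyC n P0) M) (fun i => bg_comp i j).

End LocalCohomology.

Section Regularity.
Variables (K : fieldType) (n : nat).
Local Notation P0 := {mpoly K[n]}.

(* A minimal graded free resolution of N by finitely generated modules
   F_p = \bigoplus_k P0(- a p k): elements of F_p are row vectors, F_p.+1 -> F_p
   is right multiplication by D p, and F_0 -> N sends the basis to u. The
   resolution is minimal when the image of F_p.+1 lies in (x_1, ..., x_n) F_p. *)
Record min_graded_free_resolution (N : graded P0) (b : nat -> nat)
    (a : forall p, 'I_(b p) -> int) (u : 'I_(b 0%N) -> N)
    (D : forall p, 'M[P0]_(b p.+1, b p)) : Prop := {
  res_aug_homog : forall k, gr_comp (a 0%N k) (u k);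
  res_diff_homog : forall p k l, P0_comp (a p.+1 k - a p l) (D p k l);
  res_minimal : forall p k l, (D p k l)@_0 = 0;
  res_surj : forall i x, gr_comp i x ->
    exists v : 'rV[P0]_(b 0%N), x = \sum_k v 0 k *: u k;
  res_exact0 : forall v : 'rV[P0]_(b 0%N),
    \sum_k v 0 k *: u k = 0 <-> exists w, v = w *m D 0%N;
  res_exactS : forall p (v : 'rV[P0]_(b p.+1)),
    v *m D p = 0 <-> exists w, v = w *m D p.+1 }.

(* reg N = c, for the maximum of all shifts a p k - p; regularity is only defined
   for N <> 0. *)
Definition reg_eq (N : graded P0) (c : int) : Prop :=
  (exists i x, gr_comp (g := N) i x /\ x <> 0) /\
  exists b a u D, [/\ @min_graded_free_resolution N b a u D,
    exists p k, a p k - p%:Z = c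
    & forall p k, a p k - p%:Z <= c].

End Regularity.

Definition zariski_open (K : fieldType) (n : nat) (V : set 'rV[K]_n) : Prop :=
  exists S : set {mpoly K[n]},
    V = [set x | exists2 p, S p & p.@[fun i => x 0 i] != 0].

Definition f_lambda (K : fieldType) (n : nat) (lam : 'rV[K]_n) :
    {mpoly {mpoly K[n]}[n]} :=
  \sum_i (lam 0 i *: 'X_i)%:MP * 'X_i.

(* Main.v *)
From HB Require Import structures.
Require Import Defs.
From mathcomp Require Import all_boot all_order all_algebra.
From mathcomp Require Import zify ring.
From mathcomp Require Import boolp classical_sets mpoly.

Set Implicit Arguments.
Unset Strict Implicit.
Unset Printing Implicit Defensive.

Import Order.TTheory GRing.Theory Num.Theory.

Local Open Scope classical_set_scope.
Local Open Scope ring_scope.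

(** Write j = -n-d with d >= 0, and assume that all lam_i are nonzero, which defines
    the open set V.

    The top local cohomology of P is the module of inverse polynomials in y. In
    characteristic 0 the rule y^(-1-c) |-> z^c / c! identifies it with P_0[z], with
    y_i acting as d/dz_i, so that f_lambda acts as the polarization operator
    D = sum_i lam_i x_i d/dz_i. Since H^(n-1)(P) = 0, the exact sequence
    0 -> P -> P -> P/f^r -> 0 identifies H^(n-1)(P/f^r) in y-degree j with the kernel
    of D^r on polynomials of z-degree d + r, where the x-degree is shifted by r
    (represents, represents0, represents_zero, kernel_represented,
    component_represented).

    With D' = sum_i lam_i^-1 z_i d/dx_i, the operators D and D' generate an action of
    sl2 on P_0[z] for which bidegree (e, d) has weight e - d. By the Lefschetz
    properties of sl2-actions, D^r is injective on bidegree (e, d + r) for e <= d and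
    maps onto bidegree (e + r, d) for e >= d. Therefore the kernel of D^r starts in
    x-degree d + 1, while the cokernel of D^r on z-degree d + r has finite length and
    vanishes in x-degrees >= d + r. Chasing this through Koszul homology, which
    vanishes for free modules by Cartan's homotopy formula, shows that the kernel is
    (d + 1)-regular (polar_kernel_koszul_exact, from koszul_exact_kernel and
    iter_polar_surjective). It is nonzero since powers of the minor
    lam_0 x_0 z_1 - lam_1 x_1 z_0 are killed by D.

    A graded module that starts in degree q and is q-regular has a linear minimal
    resolution: a basis of its component of degree q generates it, and the syzygies
    of this basis start in degree 1 and are 1-regular, so the construction can be
    iterated (linear_cover, linear_resolution). With the shift by r, step p of the
    resolution has all its generators in degree d + 1 + r + p, and the regularity is
    d + 1 + r = -n - j + r + 1. *)

(** * Lefschetz properties of sl2-actions *)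

Section IterAdditive.
Variable V : zmodType.

Lemma iter_raddf0 (f : {additive V -> V}) m : iter m f 0 = 0.
Proof. by elim: m => //= m ->; rewrite raddf0. Qed.

Lemma iter_raddfB (f : {additive V -> V}) m : {morph iter m f : u v / u - v}.
Proof. by move=> u v; elim: m => //= m ->; rewrite raddfB. Qed.

Lemma iter_raddfMz (f : {additive V -> V}) m c : {morph iter m f : u / u *~ c}.
Proof. by move=> u; elim: m => //= m ->; rewrite raddfMz. Qed.

End IterAdditive.

(** E and F raise and lower the weight by 2, and [E, F] is multiplication by the
    weight. As weights are integers, V need only be a torsion-free abelian group. *)
Section Sl2.
Variables (V : zmodType) (E F : {additive V -> V}) (W : int -> V -> Prop).
Hypothesis tf : forall (c : int) (v : V), c != 0 -> v *~ c = 0 -> v = 0.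
Hypothesis WF : forall w v, W w v -> W (w - 2) (F v).
Hypothesis EF : forall w v, W w v -> E (F v) = F (E v) + v *~ w.
Hypothesis WE : forall w v, W w v -> W (w + 2) (E v).

Lemma sl2_commutator k w v : W w v ->
  iter k.+1 E (F v) = F (iter k.+1 E v) + iter k E v *~ (k.+1%:Z * (w + k%:Z)).
Proof.
move=> Wv; elim: k => [|k IH]; first by rewrite /= (EF Wv) mul1r addr0.
have Wk : forall m, W (w + 2 * m%:Z) (iter m E v).
  elim=> [|m IHm]; first by rewrite mulr0 addr0.
  by have := WE IHm; rewrite iterS; congr (W _ _); lia.
rewrite iterS {}IH raddfD raddfMz -iterS (EF (Wk k.+1)) -addrA -mulrzDr.
by congr (_ + _ *~ _); lia.
Qed.

(** Moving one F across the powers of E multiplies by (k + 1) (w + k), by the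
    formula for [E^(k+1), F] and E^(k+1) v = 0; the vector F v then has weight
    w - 2 and is killed by E^(k+2). After r such moves the factor is a product of
    terms (k + 1 + i) (w + k - i) with i < r, nonzero because w + k >= r. This
    replaces the decomposition of V into irreducible representations. *)
Lemma sl2_descent r k w v :
    W w v -> iter k.+1 E v = 0 -> r%:Z <= w + k%:Z ->
  exists2 c : int, c != 0 & iter (k + r) E (iter r F v) = iter k E v *~ c.
Proof.
elim: r k w v => [|r IH] k w v Wv Ev rw; first by exists 1; rewrite ?addn0.
have Ev1 : iter k.+1 E (F v) = iter k E v *~ (k.+1%:Z * (w + k%:Z)).
  by rewrite (sl2_commutator _ Wv) Ev raddf0 add0r.
have [||c c0 e] := IH k.+1 (w - 2) (F v) (WF Wv).
- rewrite iterS Ev1 raddfMz.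
  by move: Ev; rewrite iterS => ->; rewrite mul0rz.
- lia.
exists ((k.+1%:Z * (w + k%:Z)) * c); first by rewrite !mulf_neq0 //; lia.
by rewrite [iter r.+1 F v]iterSr -addSnnS e Ev1 -mulrzA.
Qed.

(** F^r is injective on weights w >= r: by sl2_descent, F^r v = 0 and
    E^(k+1) v = 0 force E^k v = 0, and one descends to k = 0. *)
Lemma sl2_injective r k w v :
  W w v -> iter k E v = 0 -> r%:Z <= w -> iter r F v = 0 -> v = 0.
Proof.
move=> Wv; elim: k => [|k IH] // Ev rw Fv; apply: IH => //.
have [|c c0 e] := sl2_descent (r := r) Wv Ev; first by lia.
by apply: (tf c0); rewrite -e Fv iter_raddf0.
Qed.

(** S and S' stand for the weight spaces of weights w and w - 2r, where w >= r.
    If E^(k+1) v = 0, then E^k kills the difference of v and a suitable rational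
    multiple of E^r F^r v, so v lies in the image of E^r by induction on k. *)
Lemma sl2_surjective (S S' : V -> Prop) r k w v :
    (forall u, S u -> W w u) ->
    (forall (c : int) u, c != 0 -> S u -> exists2 u', S u' & u = u' *~ c) ->
    (forall u u', S u -> S u' -> S (u - u')) ->
    (forall u, S u -> S' (iter r F u)) ->
    (forall u, S' u -> S (iter r E u)) ->
    S' 0 -> (forall u u', S' u -> S' u' -> S' (u + u')) ->
    r%:Z <= w -> S v -> iter k E v = 0 ->
  exists2 u, S' u & v = iter r E u.
Proof.
move=> SW Sdiv SB SF SE S0 SD rw.
elim: k v => [|k IH] v Sv Ev.
  by exists 0 => //; rewrite iter_raddf0.
have [|c c0 e] := sl2_descent (r := r) (SW _ Sv) Ev; first by lia.
have [u Su vu] := Sdiv _ _ c0 Sv.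
have Eu : iter (k + r) E (iter r F u) = iter k E v.
  apply/eqP; rewrite -subr_eq0; apply/eqP; apply: (tf c0).
  by rewrite mulrzBl -!iter_raddfMz -vu e iter_raddfMz subrr.
have [||u' Su' vu'] := IH (v - iter r E (iter r F u)).
- by apply: SB => //; apply/SE/SF.
- by rewrite iter_raddfB -iterD Eu subrr.
exists (u' + iter r F u); first by apply: SD => //; apply: SF.
have := iter_raddfB E r u' (- iter r F u); rewrite opprK => ->.
have := iter_raddfB E r 0 (iter r F u); rewrite iter_raddf0 !sub0r => ->.
by rewrite opprK -vu' subrK.
Qed.
End Sl2.

(** * Coefficients, homogeneity and Euler formulas *)

Section MonomialCoefficients.
Variables (R : comNzRingType) (n : nat).
Implicit Types (p : {mpoly R[n]}) (m : 'X_{1..n}).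

Lemma mcoeffXM m0 p m :
  ('X_[m0] * p)@_m = if (m0 <= m)%MM then p@_(m - m0) else 0.
Proof.
rewrite mulrC; case: ifP => [le|nle].
  by rewrite -{1}(submK le) addmC mcoeffMX.
apply/eqP; rewrite mcoeff_eq0 (perm_mem (msuppMX p m0)).
by apply/negP => /mapP [m' _ e]; rewrite e lem_addr in nle.
Qed.

Lemma mcoeffXUM i p m :
  ('X_i * p)@_m = if m i == 0%N then 0 else p@_(m - U_(i)).
Proof. by rewrite mcoeffXM lep1mP; case: eqP. Qed.

Lemma mcoeff_euler p m :
  (\sum_i 'X_i * p^`M(i))@_m = p@_m *+ mdeg m.
Proof.
rewrite raddf_sum mdegE -sumrMnr /=; apply: eq_bigr => i _.
rewrite mcoeffXUM; case: eqP => [->|/eqP mi]; first by rewrite mulr0n.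
rewrite mcoeff_mderiv submK ?lep1mP // mnmBE mnm1E eqxx.
by rewrite subn1 prednK // lt0n.
Qed.

Lemma mcoeff_pihomog d p m :
  (pihomog mdeg d p)@_m = if mdeg m == d then p@_m else 0.
Proof.
have h := pihomogP mdeg d p.
case: ifP => [/eqP md|/negbT md]; last exact: dhomog_nemf_coeff h md.
rewrite /pihomog raddf_sum /= (eq_bigr (fun m' : 'X_{1..n} => p@_m' * (m' == m)%:R)); last first.
  by move=> m' _; rewrite mcoeffZ mcoeffX.
case: (boolP (m \in msupp p)) => mp.
  rewrite big_mkcond (bigD1_seq m) //= md !eqxx mulr1 big1 ?addr0 //.
  by move=> m' /negPf ->; rewrite mulr0 if_same.
rewrite big1_seq => [|m' /andP [_ m'p]]; first by rewrite memN_msupp_eq0.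
by case: eqP => [e|_]; [rewrite -e m'p in mp | rewrite mulr0].
Qed.
End MonomialCoefficients.

(** Compares the two double sums of the sl2 commutator, whose terms agree off the
    diagonal. *)
Lemma sum_differ_at (V : zmodType) (I : finType) (f g : I -> V) i :
  (forall j, j != i -> f j = g j) -> \sum_j f j = \sum_j g j + (f i - g i).
Proof.
move=> fg; rewrite (bigD1 i) //= [\sum_j g j](bigD1 i) //= (eq_bigr g) //.
by rewrite addrC [g i + _]addrC -addrA; congr (_ + _); rewrite addrC subrK.
Qed.

Section Homogeneous.
Variables (R : comNzRingType) (n : nat).
Implicit Types p q : {mpoly R[n]}.

Definition hom (e : nat) (p : {mpoly R[n]}) : Prop := forall k, p@_k != 0 -> mdeg k = e.

Lemma hom0 e : hom e 0.
Proof. by move=> k; rewrite mcoeff0 eqxx. Qed.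

Lemma homD e p q : hom e p -> hom e q -> hom e (p + q).
Proof.
move=> hp hq k; rewrite mcoeffD; case: (eqVneq p@_k 0) => [->|/hp //].
by rewrite add0r => /hq.
Qed.

Lemma homN e p : hom e p -> hom e (- p).
Proof. by move=> hp k; rewrite mcoeffN oppr_eq0 => /hp. Qed.

Lemma hom_sum e (I : Type) (r : seq I) (Q : pred I) (f : I -> {mpoly R[n]}) :
  (forall i, Q i -> hom e (f i)) -> hom e (\sum_(i <- r | Q i) f i).
Proof. by move=> h; elim/big_rec: _ => [|i p Qi]; [exact: hom0 | apply: homD; apply: h]. Qed.

Lemma homC (c : R) : hom 0 c%:MP.
Proof.
by move=> k; rewrite mcoeffC; case: (eqVneq k 0%MM) => [->|_]; rewrite ?mdeg0 // mulr0 eqxx.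
Qed.

Lemma homX i : hom 1 'X_i.
Proof.
move=> k; rewrite mcoeffX.
by case: (eqVneq U_(i)%MM k) => [<-|_]; rewrite ?mdeg1 // eqxx.
Qed.

Lemma homM e f p q : hom e p -> hom f q -> hom (e + f) (p * q).
Proof.
move=> hp hq k; rewrite mcoeffM; apply: contra_neq_eq => ke.
rewrite big1 // => -[m1 m2] /= /eqP kE.
case: (eqVneq p@_m1 0) => [->|/hp e1]; first by rewrite mul0r.
case: (eqVneq q@_m2 0) => [->|/hq e2]; first by rewrite mulr0.
by case/eqP: ke; rewrite kE mdegD e1 e2.
Qed.

Lemma hom_mderiv e i p : hom e.+1 p -> hom e p^`M(i).
Proof.
move=> hp k; rewrite mcoeff_mderiv => h.
suff /hp : p@_(k + U_(i)) != 0 by rewrite mdegD mdeg1 addn1 => -[].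
by apply: contraNneq h => ->; rewrite mul0rn.
Qed.

Lemma hom_mderiv0 i p : hom 0 p -> p^`M(i) = 0.
Proof.
move=> hp; apply/mpolyP => k; rewrite mcoeff_mderiv mcoeff0.
case: (eqVneq p@_(k + U_(i)) 0) => [->|/hp]; first by rewrite mul0rn.
by rewrite mdegD mdeg1 addn1.
Qed.

Lemma euler e p : hom e p -> \sum_i 'X_i * p^`M(i) = p *+ e.
Proof.
move=> hp; apply/mpolyP => k; rewrite mcoeff_euler mcoeffMn.
by case: (eqVneq p@_k 0) => [->|/hp ->]; rewrite ?mul0rn.
Qed.

Lemma hom_pihomog e p : hom e (pihomog mdeg e p).
Proof. by move=> k; rewrite mcoeff_pihomog; case: (eqVneq (mdeg k) e) => // _; rewrite eqxx. Qed.

Lemma pihomogM_hom e f p a : hom f a ->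
  pihomog mdeg (e + f) (p * a) = pihomog mdeg e p * a.
Proof.
move=> ha; apply/mpolyP => m; rewrite mcoeff_pihomog.
case: eqP => [me|/eqP me]; last first.
  apply/esym/eqP/negPn/negP => /(homM (@hom_pihomog e p) ha) /eqP.
  by rewrite (negPf me).
rewrite !mcoeffM; apply: eq_bigr => -[m1 m2] /= /eqP /(congr1 mdeg).
rewrite mdegD => mE.
rewrite mcoeff_pihomog; case: eqP => // m1e.
case: (eqVneq a@_m2 0) => [->|/ha m2f]; first by rewrite !mulr0.
by case: m1e; move: me; rewrite {1}mE m2f => /addIn.
Qed.

Lemma pihomog_hom e p :
  hom e p -> pihomog mdeg e p = p.
Proof.
move=> hp; apply/mpolyP => m; rewrite mcoeff_pihomog; case: eqP => // me.
by apply/esym/eqP/negPn/negP => /hp.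
Qed.

Lemma hom_prod (I : finType) (Q : pred I) (F : I -> {mpoly R[n]}) :
  (forall i, hom 1 (F i)) -> hom #|Q| (\prod_(i | Q i) F i).
Proof.
move=> h; rewrite -sum1_card; elim/big_rec2: _ => [|i e p Qi IH]; last exact: homM.
by rewrite -mpolyC1; apply: homC.
Qed.

Lemma homXn e t p : hom e p -> hom (t * e) (p ^+ t).
Proof.
move=> h; elim: t => [|t IH]; first by rewrite expr0 -mpolyC1; apply: homC.
by rewrite exprS mulSn; apply: homM.
Qed.

End Homogeneous.

Section Weyl.
Variables (K : fieldType) (n : nat).
Local Notation P0 := {mpoly K[n]}.
Local Notation P := {mpoly {mpoly K[n]}[n]}.

(** P is read as P_0[z], with x-degree e and z-degree d; the zero polynomial is
    homogeneous of every degree. *)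
Definition bihom (e d : nat) (p : P) : Prop :=
  forall m k, p@_m@_k != 0 -> mdeg m = d /\ mdeg k = e.

Lemma bihomE e d p : bihom e d p <->
  (forall m, p@_m != 0 -> mdeg m = d) /\ (forall m, hom e p@_m).
Proof.
split=> [h|[h1 h2] m k pmk]; last first.
  by split; [apply: h1; apply: contraNneq pmk => ->; rewrite mcoeff0 | apply: h2 pmk].
split=> [m|m k pmk]; last by case: (h m k pmk).
case: (eqVneq (mdeg m) d) => // md; case/eqP; apply/mpolyP => k; rewrite mcoeff0.
by apply/eqP/negPn/negP => /h [] /eqP; rewrite (negPf md).
Qed.

Lemma bihom0 e d : bihom e d 0.
Proof. by move=> m k; rewrite !mcoeff0 eqxx. Qed.

Lemma bihomD e d p q : bihom e d p -> bihom e d q -> bihom e d (p + q).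
Proof.
move=> hp hq m k; rewrite !mcoeffD; case: (eqVneq p@_m@_k 0) => [->|/hp //].
by rewrite add0r => /hq.
Qed.

Lemma bihomN e d p : bihom e d p -> bihom e d (- p).
Proof. by move=> hp m k; rewrite !mcoeffN oppr_eq0 => /hp. Qed.

Lemma bihom_sum e d (I : Type) (r : seq I) (Q : pred I) (f : I -> P) :
  (forall i, Q i -> bihom e d (f i)) -> bihom e d (\sum_(i <- r | Q i) f i).
Proof. by move=> h; elim/big_rec: _ => [|i p Qi]; [exact: bihom0 | apply: bihomD; apply: h]. Qed.

Lemma bihomZ e f d a p : hom f a -> bihom e d p -> bihom (f + e) d (a *: p).
Proof.
move=> ha /bihomE [h1 h2]; apply/bihomE; split=> m.
  by move=> h; apply: h1; apply: contraNneq h; rewrite mcoeffZ => ->; rewrite mulr0.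
by rewrite mcoeffZ; apply: homM.
Qed.

Lemma bihomM e d e' d' p q :
  bihom e d p -> bihom e' d' q -> bihom (e + e') (d + d') (p * q).
Proof.
move=> /bihomE [p1 p2] /bihomE [q1 q2]; apply/bihomE; split=> m; last first.
  by rewrite mcoeffM; apply: hom_sum => -[m1 m2] _ /=; apply: homM.
rewrite mcoeffM; apply: contra_neq_eq => ke.
rewrite big1 // => -[m1 m2] /= /eqP kE.
case: (eqVneq p@_m1 0) => [->|/p1 e1]; first by rewrite mul0r.
case: (eqVneq q@_m2 0) => [->|/q1 e2]; first by rewrite mulr0.
by case/eqP: ke; rewrite kE mdegD e1 e2.
Qed.

Lemma bihomXn e d p r : bihom e d p -> bihom (e * r) (d * r) (p ^+ r).
Proof.
move=> hp; elim: r => [|r IH]; last by rewrite exprS !mulnS; apply: bihomM.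
move=> m k; rewrite expr0 !muln0 mcoeff1; case: (eqVneq m 0%MM) => [->|_].
  by rewrite mcoeff1 mdeg0; case: (eqVneq k 0%MM) => [->|_]; rewrite ?mdeg0 ?eqxx.
by rewrite mcoeff0 eqxx.
Qed.

Lemma bihom_mderiv e d i p : bihom e d.+1 p -> bihom e d p^`M(i).
Proof.
move=> hp m k; rewrite mcoeff_mderiv mcoeffMn => h.
suff /hp : p@_(m + U_(i))@_k != 0 by rewrite mdegD mdeg1 addn1 => -[[-> ->]].
by apply: contraNneq h => ->; rewrite mul0rn.
Qed.

Lemma bihom_mderiv0 e i p : bihom e 0 p -> p^`M(i) = 0.
Proof.
move=> /bihomE [hp _]; apply/mpolyP => k; rewrite mcoeff_mderiv mcoeff0.
case: (eqVneq p@_(k + U_(i)) 0) => [->|/hp]; first by rewrite mul0rn.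
by rewrite mdegD mdeg1 addn1.
Qed.

Lemma bihomXU i : bihom 0 1 ('X_i : P).
Proof.
move=> m k; rewrite mcoeffX; case: (eqVneq U_(i)%MM m) => [<-|_]; last by rewrite mcoeff0 eqxx.
rewrite mdeg1 mcoeff1; case: (eqVneq k 0%MM) => [->|_]; rewrite ?mdeg0 //.
by rewrite eqxx.
Qed.

(** The derivation with respect to x_i, acting on the coefficients. *)
Definition dx (i : 'I_n) : P -> P := map_mpoly (mderiv i).

HB.instance Definition _ i := GRing.Additive.copy (dx i) (map_mpoly (mderiv i)).

Lemma mcoeff_dx i p m : (dx i p)@_m = (p@_m)^`M(i).
Proof. exact: mcoeff_map_mpoly. Qed.

Lemma bihom_dx e d i p : bihom e.+1 d p -> bihom e d (dx i p).
Proof.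
move=> /bihomE [h1 h2]; apply/bihomE; split=> m; rewrite mcoeff_dx.
  by move=> h; apply: h1; apply: contraNneq h => ->; rewrite mderiv0.
exact: hom_mderiv.
Qed.

Lemma bihom_dx0 d i p : bihom 0 d p -> dx i p = 0.
Proof.
by move=> /bihomE [_ h2]; apply/mpolyP => m; rewrite mcoeff_dx hom_mderiv0 ?mcoeff0.
Qed.

Lemma dxZ i a p : dx i (a *: p) = a^`M(i) *: p + a *: dx i p.
Proof.
by apply/mpolyP => m; rewrite !(mcoeff_dx, mcoeffD, mcoeffZ) mderivM.
Qed.

Lemma dx_mderiv i j p : dx i p^`M(j) = (dx i p)^`M(j).
Proof.
by apply/mpolyP => m; rewrite !(mcoeff_dx, mcoeff_mderiv) mderivMn.
Qed.

Lemma mderivXU (R : comNzRingType) i j :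
  ('X_j : {mpoly R[n]})^`M(i) = (i == j)%:R.
Proof.
rewrite mderivX mnm1E eq_sym; case: eqP => [->|_]; last by rewrite scale0r.
rewrite scale1r -mpolyX0; congr 'X_[_]; apply/mnmP => k; by rewrite mnmBE subnn mnm0E.
Qed.

Lemma mderivXM i j p : ('X_j * p)^`M(i) = p *+ (i == j) + 'X_j * p^`M(i) :> P.
Proof. by rewrite mderivM mderivXU mulr_natl. Qed.

Lemma euler_x e d (p : P) : bihom e d p -> \sum_i 'X_i *: dx i p = p *+ e.
Proof.
move=> /bihomE [_ h2]; apply/mpolyP => m; rewrite raddf_sum mcoeffMn -(euler (h2 m)).
by apply: eq_bigr => i _ /=; rewrite mcoeffZ mcoeff_dx.
Qed.

Lemma euler_z e d (p : P) : bihom e d p -> \sum_i 'X_i * p^`M(i) = p *+ d.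
Proof.
move=> /bihomE [h1 _]; apply/mpolyP => m; rewrite mcoeff_euler mcoeffMn.
by case: (eqVneq p@_m 0) => [->|/h1 ->]; rewrite ?mul0rn.
Qed.

Section Lambda.
Variable (lam : 'I_n -> K).
Hypothesis lam0 : forall i, lam i != 0.

(** The polarization D = sum_i lam_i x_i d/dz_i and its adjoint
    D' = sum_i lam_i^-1 z_i d/dx_i: D lowers the z-degree and raises the x-degree by
    one, and D' does the opposite. *)
Definition polar (p : P) : P := \sum_i (lam i *: 'X_i : P0) *: p^`M(i).
Definition copolar (p : P) : P := \sum_i (lam i)^-1%:MP *: ('X_i * dx i p).

Lemma mcoeff_polar p m :
  (polar p)@_m = \sum_i (lam i *: 'X_i) * (p@_(m + U_(i)) *+ (m i).+1).
Proof.
rewrite /polar raddf_sum; apply: eq_bigr => i _.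
by rewrite -mcoeff_mderiv; apply: mcoeffZ.
Qed.

Fact polar_is_linear : linear polar.
Proof.
move=> a p q; rewrite /polar scaler_sumr -big_split; apply: eq_bigr => i _ /=.
by rewrite mderivD mderivZ scalerDr !scalerA mulrC.
Qed.
HB.instance Definition _ := GRing.isLinear.Build P0 P P _ polar polar_is_linear.

Fact copolar_is_additive : zmod_morphism copolar.
Proof.
move=> p q; rewrite /copolar -sumrB; apply: eq_bigr => i _ /=.
by rewrite raddfB mulrBr scalerBr.
Qed.
HB.instance Definition _ := GRing.isZmodMorphism.Build P P copolar copolar_is_additive.

Lemma polarM p q : polar (p * q) = polar p * q + p * polar q.
Proof.
rewrite /polar mulr_suml mulr_sumr -big_split; apply: eq_bigr => i _ /=.
by rewrite mderivM scalerDr -scalerAl -scalerAr.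
Qed.

Lemma bihom_polar e d p : bihom e d.+1 p -> bihom e.+1 d (polar p).
Proof.
move=> hp; apply: bihom_sum => i _; rewrite -add1n; apply: bihomZ; last exact: bihom_mderiv.
by rewrite -mul_mpolyC; apply: (@homM _ _ 0 1); [apply: homC | apply: homX].
Qed.

Lemma bihom_polar0 e p : bihom e 0 p -> polar p = 0.
Proof. by move=> hp; rewrite /polar big1 // => i _; rewrite (bihom_mderiv0 _ hp) scaler0. Qed.

Lemma bihom_copolar e d p : bihom e.+1 d p -> bihom e d.+1 (copolar p).
Proof.
move=> hp; apply: bihom_sum => i _; apply: (@bihomZ e 0 d.+1); first exact: homC.
by apply: (@bihomM 0 1 e d); [apply: bihomXU | apply: bihom_dx hp].
Qed.

Lemma bihom_copolar0 d p : bihom 0 d p -> copolar p = 0.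
Proof.
by move=> hp; rewrite /copolar big1 // => i _; rewrite (bihom_dx0 _ hp) mulr0 scaler0.
Qed.

(** [x_i d/dz_i, z_j d/dx_j] vanishes for i <> j and is x_i d/dx_i - z_i d/dz_i for
    i = j; summing over i, the Euler formulas turn [D, D'] into e - d. *)
Lemma polar_copolar e d p : bihom e d p ->
  polar (copolar p) = copolar (polar p) + (p *+ e - p *+ d).
Proof.
move=> hp; rewrite -(euler_x hp) -(euler_z hp).
have -> : polar (copolar p) =
    \sum_i \sum_j (lam i * (lam j)^-1)%:MP *: ('X_i *: ((dx j p) *+ (i == j)
                    + 'X_j * (dx j p)^`M(i))).
  apply: eq_bigr => i _; rewrite /copolar (raddf_sum (mderiv i)) scaler_sumr.
  apply: eq_bigr => j _ /=; rewrite mderivZ mderivXM !scalerA; congr (_ *: _).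
  by rewrite mpolyCM -mul_mpolyC; ring.
have -> : copolar (polar p) =
    \sum_i \sum_j (lam i * (lam j)^-1)%:MP *: ('X_j * (p^`M(i) *+ (i == j)
                    + 'X_i *: (dx j p)^`M(i))).
  rewrite exchange_big; apply: eq_bigr => j _; rewrite /polar (raddf_sum (dx j)) mulr_sumr.
  rewrite scaler_sumr; apply: eq_bigr => i _ /=.
  rewrite dxZ mderivZ mderivXU dx_mderiv.
  rewrite -(mul_mpolyC (lam i)) -(mul_mpolyC (lam i) 'X_i) -!scalerA -scalerDr.
  rewrite -scalerAr !scalerA scaler_nat eq_sym; congr (_ *: _).
  by rewrite mulrC -mpolyCM.
rewrite -sumrB -big_split /=; apply: eq_bigr => i _.
have -> : 'X_i *: dx i p - 'X_i * p^`M(i) =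
    (lam i / lam i)%:MP *: ('X_i *: (dx i p *+ (i == i) + 'X_i * (dx i p)^`M(i)))
  - (lam i / lam i)%:MP *: ('X_i * (p^`M(i) *+ (i == i) + 'X_i *: (dx i p)^`M(i))).
  rewrite (divff (lam0 i)) !scale1r !eqxx !mulr1n scalerDr mulrDr -scalerAr.
  by rewrite opprD addrACA subrr addr0.
apply: (sum_differ_at (i := i)) => j; rewrite eq_sym => /negPf ->.
by rewrite !mulr0n !add0r scalerAr.
Qed.
End Lambda.
End Weyl.

(** * Injectivity and surjectivity of the powers of the polarization *)

Lemma mulIf_mpoly (R : idomainType) n (a b f : {mpoly R[n]}) :
  f != 0 -> a * f = b * f -> a = b.
Proof. by move=> f0; apply: mulIf. Qed.

Lemma expf_neq0_mpoly (R : idomainType) n (f : {mpoly R[n]}) r : f != 0 -> f ^+ r != 0.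
Proof. exact: expf_neq0. Qed.

Lemma mulX_neq0 (R : idomainType) n (x y : {mpoly R[n]}) a b :
  x != 0 -> y != 0 -> x ^+ a * y ^+ b != 0.
Proof. by move=> x0 y0; rewrite mulf_neq0 // expf_neq0. Qed.

Section PolarLefschetz.
Variables (K : fieldType) (n : nat).
Hypothesis charK : [pchar K] =i pred0.
Local Notation P := {mpoly {mpoly K[n]}[n]}.

Lemma natf_neq0 m : m != 0%N -> (m%:R : K) != 0.
Proof. by rewrite (proj1 (pcharf0P _) charK). Qed.

Lemma intf_neq0 (c : int) : c != 0 -> (c%:~R : K) != 0.
Proof.
case: c => m c0; first by rewrite -pmulrn; apply: natf_neq0.
by rewrite NegzE mulrNz oppr_eq0 -pmulrn natf_neq0.
Qed.

Lemma mpoly_torsion_free (c : int) (v : P) : c != 0 -> v *~ c = 0 -> v = 0.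
Proof.
move=> c0 vc; apply/mpolyP => m; apply/mpolyP => k; rewrite !mcoeff0.
have : (v *~ c)@_m@_k = 0 by rewrite vc !mcoeff0.
rewrite !raddfMz /= -mulrzr => /eqP; rewrite mulf_eq0 (negPf (intf_neq0 c0)) orbF.
by move/eqP.
Qed.

Variable (lam : 'I_n -> K).
Hypothesis lam0 : forall i, lam i != 0.
Local Notation D := (polar lam).
Local Notation D' := (copolar lam).

Lemma bihom_iter_polar r e d v :
  bihom e (d + r) v -> bihom (e + r) d (iter r D v).
Proof.
elim: r e v => [|r IH] e v hv; first by rewrite addn0; move: hv; rewrite addn0.
by rewrite iterSr -addSnnS; apply: IH; apply: bihom_polar; rewrite -addnS.
Qed.

Lemma bihom_iter_copolar r e d v :
  bihom (e + r) d v -> bihom e (d + r) (iter r D' v).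
Proof.
elim: r d v => [|r IH] d v hv; first by rewrite addn0; move: hv; rewrite addn0.
by rewrite iterSr -addSnnS; apply: IH; apply: bihom_copolar; rewrite -addnS.
Qed.

Lemma iter_polar_eq0 e d v : bihom e d v -> iter d.+1 D v = 0.
Proof.
elim: d e v => [|d IH] e v hv; first exact: bihom_polar0 hv.
by rewrite iterSr; apply: IH; apply: bihom_polar hv.
Qed.

Lemma iter_copolar_eq0 e d v : bihom e d v -> iter e.+1 D' v = 0.
Proof.
elim: e d v => [|e IH] d v hv; first exact: bihom_copolar0 hv.
by rewrite iterSr; apply: IH; apply: bihom_copolar hv.
Qed.

(** The existential makes weight_polar and weight_copolar hold without case
    distinction on the bidegree: where D or D' leaves the first quadrant its
    value is zero, which has every weight. *)
Definition weight (w : int) (v : P) := exists e d, bihom e d v /\ w = e%:Z - d%:Z.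

Lemma weight_polar w v : weight w v -> weight (w + 2) (D v).
Proof.
move=> [e [[|d] [hv ->]]].
  exists e.+2, 0%N; split; last by lia.
  by rewrite (bihom_polar0 _ hv); apply: bihom0.
by exists e.+1, d; split; [apply: bihom_polar | lia].
Qed.

Lemma weight_copolar w v : weight w v -> weight (w - 2) (D' v).
Proof.
move=> [[|e] [d [hv ->]]].
  exists 0%N, d.+2; split; last by lia.
  by rewrite (bihom_copolar0 _ hv); apply: bihom0.
by exists e, d.+1; split; [apply: bihom_copolar | lia].
Qed.

Lemma weight_commutator w v : weight w v -> D (D' v) = D' (D v) + v *~ w.
Proof. by move=> [e [d [hv ->]]]; rewrite (polar_copolar lam0 hv) mulrzBr. Qed.

(** The weights e - d - r <= -r are those where D^r is injective: this is
    sl2_injective with the roles of D and D' exchanged. *)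
Lemma iter_polar_injective r e d v :
  bihom e (d + r) v -> (e <= d)%N -> iter r D v = 0 -> v = 0.
Proof.
move=> hv ed.
apply: (@sl2_injective P D' D (fun w => weight (- w)) _ _ _ _ r e.+1 (d + r - e)%N%:Z).
- exact: mpoly_torsion_free.
- by move=> w u /weight_polar; congr weight; lia.
- move=> w u wu; rewrite /= (weight_commutator wu).
  by rewrite mulrNz addrNK.
- by move=> w u /weight_copolar; congr weight; lia.
- by exists e, (d + r)%N; split=> //; lia.
- exact: iter_copolar_eq0 hv.
- by lia.
Qed.

(** The target has weight e + r - d >= r. *)
Lemma iter_polar_surjective r e d v :
  bihom (e + r) d v -> (d <= e)%N ->
  exists2 u, bihom e (d + r) u & v = iter r D u.
Proof.
move=> hv ed.
apply: (@sl2_surjective P D D' weight mpoly_torsion_free weight_copolar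
  weight_commutator weight_polar (bihom (e + r) d) _ r d.+1 ((e + r)%N%:Z - d%:Z)) => //.
- by move=> u hu; exists (e + r)%N, d.
- move=> c u c0 hu; exists ((c%:~R : K)^-1%:MP *: u).
    by apply: (@bihomZ _ _ (e + r) 0) => //; apply: homC.
  have cK : (c%:~R : K)^-1 *~ c = 1 by rewrite -mulrzr mulVf ?intf_neq0.
  by rewrite scalerMzl -rmorphMz cK scale1r.
- by move=> u u' hu hu'; apply: bihomD => //; apply: bihomN.
- exact: bihom_iter_copolar.
- exact: bihom_iter_polar.
- exact: bihom0.
- exact: bihomD.
- by lia.
- exact: iter_polar_eq0 hv.
Qed.

Lemma polar_X j : D 'X_j = (lam j *: 'X_j) *: 1.
Proof.
rewrite /polar (bigD1 j) //= mderivXU eqxx big1 ?addr0 // => i ij.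
by rewrite mderivXU (negPf ij) scaler0.
Qed.

(** The 2 x 2 minor of the rows (lam_k x_k) and (z_k); D maps the second row to
    the first, so it kills the minor. *)
Definition minor (i j : 'I_n) : P :=
  (lam i *: 'X_i) *: 'X_j - (lam j *: 'X_j) *: 'X_i.

Lemma bihom_minor i j : bihom 1 1 (minor i j).
Proof.
have h a b : bihom 1 1 ((lam a *: 'X_a : {mpoly K[n]}) *: 'X_b).
  apply: (@bihomZ _ _ 0 1); last exact: bihomXU.
  by rewrite -mul_mpolyC; apply: (@homM _ _ 0 1); [apply: homC | apply: homX].
by apply: bihomD; [|apply: bihomN]; apply: h.
Qed.

Lemma polar_minor i j : D (minor i j) = 0.
Proof.
have DZ a (q : P) : D (a *: q) = a *: D q by exact: linearZ.
by rewrite /minor raddfB /= !DZ !polar_X !scalerA mulrC subrr.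
Qed.

Lemma minor_neq0 i j : i != j -> minor i j != 0.
Proof.
move=> ij; apply/eqP => /(congr1 (fun p : P => p@_U_(j)@_U_(i))).
rewrite /minor !mcoeff0 !mcoeffB !mcoeffZ !mcoeffX eqxx mulr1.
have -> : (U_(i) == U_(j) :> 'X_{1..n})%MM = false.
  apply/negP => /eqP /(congr1 (fun m : 'X_{1..n} => m j)).
  by rewrite !mnm1E eqxx (negPf ij).
rewrite mulr0 mcoeff0 subr0 mcoeffZ mcoeffX eqxx mulr1 => /eqP.
by rewrite (negPf (lam0 i)).
Qed.

(** The witness is minor^(d+1) z_0^(r-1): D is linear over the minor, and D^r kills
    z_0^(r-1) for degree reasons. *)
Lemma iter_polar_kernel_neq0 r d : (0 < r)%N -> (1 < n)%N ->
  exists v, [/\ bihom d.+1 (d + r) v, iter r D v = 0 & v != 0].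
Proof.
case: r => // r _ n2; pose i := Ordinal (ltnW n2); pose j := Ordinal n2.
have pm m q : D (minor i j ^+ m * q) = minor i j ^+ m * D q.
  elim: m q => [|m IH] q; first by rewrite !mul1r.
  by rewrite exprS -!mulrA polarM polar_minor mul0r add0r IH.
have ipm l m q : iter l D (minor i j ^+ m * q) = minor i j ^+ m * iter l D q.
  by elim: l => // l IH; rewrite !iterS IH pm.
have hX : bihom 0 r ('X_i ^+ r : P).
  by have := bihomXn (r := r) (@bihomXU K n i); rewrite mul0n mul1n.
exists (minor i j ^+ d.+1 * 'X_i ^+ r); split.
- have := bihomM (bihomXn (r := d.+1) (@bihom_minor i j)) hX.
  by rewrite !mul1n addn0 addSnnS.
- by rewrite ipm (iter_polar_eq0 hX) mulr0.
apply: (mulX_neq0 d.+1 r (@minor_neq0 i j isT)).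
apply/eqP => /(congr1 (fun p : P => p@_U_(i)@_0)).
by rewrite !mcoeff0 mcoeffX eqxx mcoeff1 eqxx => /eqP; rewrite oner_eq0.
Qed.
End PolarLefschetz.

(** * The Koszul complex of x_1, ..., x_n *)

Section Koszul.
Variables (K : fieldType) (n : nat).
Local Notation P0 := {mpoly K[n]}.

Section Complex.
Variable X : lmodType P0.

(** The Koszul complex of X on the variables of s, as an iterated mapping cone: a
    new variable x_i replaces a complex C by the cone of x_i on C, which takes the
    place of exterior powers. All homological degrees are taken together. *)
Fixpoint kos (s : seq 'I_n) : lmodType P0 :=
  if s is _ :: s' then (kos s' * kos s')%type else X.

Fixpoint kos_bd (s : seq 'I_n) : kos s -> kos s :=
  match s return kos s -> kos s with
  | [::] => fun=> 0
  | i :: s' => fun z => (kos_bd z.1 + 'X_i *: z.2, - kos_bd z.2)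
  end.

(** Chains of homological degree i all of whose components lie in S; taking for S
    a homogeneous component of X singles out an internal degree. *)
Fixpoint kos_deg (s : seq 'I_n) (i : nat) (S : X -> Prop) : kos s -> Prop :=
  match s return kos s -> Prop with
  | [::] => fun z => if i is 0%N then S z else z = 0
  | _ :: s' => fun z => kos_deg i S z.1 /\
      (if i is i'.+1 then kos_deg i' S z.2 else z.2 = 0)
  end.

Fixpoint kos_in0 (s : seq 'I_n) (u : X) : kos s :=
  match s return kos s with
  | [::] => u
  | _ :: s' => (kos_in0 s' u, 0)
  end.

Lemma kos_bd_is_linear s : linear (@kos_bd s).
Proof.
elim: s => [|i s IH] a z w; first by rewrite /= scaler0 addr0.
congr (_, _).
  rewrite -[LHS]/(kos_bd (a *: z.1 + w.1) + 'X_i *: (a *: z.2 + w.2)) IH.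
  rewrite -[RHS]/(a *: (kos_bd z.1 + 'X_i *: z.2) + (kos_bd w.1 + 'X_i *: w.2)).
  by rewrite !scalerDr !scalerA addrACA [a * _]mulrC.
rewrite -[RHS]/(a *: (- kos_bd z.2) - kos_bd w.2).
by rewrite -[LHS]/(- kos_bd (a *: z.2 + w.2)) IH opprD scalerN.
Qed.

HB.instance Definition _ s :=
  GRing.isLinear.Build P0 (kos s) (kos s) _ (@kos_bd s) (@kos_bd_is_linear s).

Lemma kos_bd0 s : @kos_bd s 0 = 0.
Proof. exact: linear0. Qed.
Lemma kos_bdD s z w : @kos_bd s (z + w) = kos_bd z + kos_bd w.
Proof. exact: linearD. Qed.
Lemma kos_bdN s z : @kos_bd s (- z) = - kos_bd z.
Proof. exact: linearN. Qed.
Lemma kos_bdB s z w : @kos_bd s (z - w) = kos_bd z - kos_bd w.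
Proof. exact: linearB. Qed.
Lemma kos_bdZ s a z : @kos_bd s (a *: z) = a *: kos_bd z.
Proof. exact: linearZ. Qed.

Lemma kos_bd_bd s z : kos_bd (@kos_bd s z) = 0.
Proof.
elim: s z => [|i s IH] z //=; congr (_, _).
  by rewrite kos_bdD kos_bdZ IH scalerN add0r subrr.
by rewrite kos_bdN IH !oppr0.
Qed.

Lemma kos_bd_in0 s u : kos_bd (kos_in0 s u) = 0.
Proof. by elim: s => [|i s IH] //=; rewrite IH kos_bd0 scaler0 addr0 oppr0. Qed.

Definition zclosed (S : X -> Prop) := S 0 /\ forall u v, S u -> S v -> S (u - v).

Lemma zclosedN S u : zclosed S -> S u -> S (- u).
Proof. by move=> [S0 SB] Su; rewrite -sub0r; apply: SB. Qed.

Lemma zclosedD S u v : zclosed S -> S u -> S v -> S (u + v).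
Proof. by move=> hS Su Sv; rewrite -[v]opprK; apply: hS.2 => //; apply: zclosedN. Qed.

Lemma zclosed_sum S (J : Type) (r : seq J) (Q : pred J) (f : J -> X) :
  zclosed S -> (forall j, Q j -> S (f j)) -> S (\sum_(j <- r | Q j) f j).
Proof.
by move=> hS h; elim/big_rec: _ => [|j u Qj]; [exact: hS.1 | apply: zclosedD => //; apply: h].
Qed.

Lemma kos_deg_in0 s S u : kos_deg 0 S (kos_in0 s u) <-> S u.
Proof. by elim: s => [|i s IH] //=; split=> [[/IH]|/IH]. Qed.

Lemma kos_deg0 s i S : S 0 -> kos_deg i S (0 : kos s).
Proof.
by move=> S0; elim: s i => [|j s IH] [|i] //=; split=> //; apply: IH.
Qed.

Lemma kos_degB s i S z w :
  zclosed S -> kos_deg i S z -> kos_deg i S w -> kos_deg i S (z - w : kos s).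
Proof.
move=> hS; elim: s i z w => [|j s IH] [|i] z w /=; first exact: hS.2.
- by move=> -> ->; rewrite subrr.
- by move=> [h ->] [h' ->]; split; [apply: IH | rewrite subrr].
- by move=> [h1 h2] [h3 h4]; split; apply: IH.
Qed.

Lemma kos_degN s i S z : zclosed S -> kos_deg i S z -> kos_deg i S (- z : kos s).
Proof. by move=> hS hz; rewrite -sub0r; apply: kos_degB => //; apply: kos_deg0; apply: hS.1. Qed.

Lemma kos_degD s i S z w :
  zclosed S -> kos_deg i S z -> kos_deg i S w -> kos_deg i S (z + w : kos s).
Proof. by move=> hS hz hw; rewrite -[w]opprK; apply: kos_degB => //; apply: kos_degN. Qed.

Lemma kos_degZ s i (S S' : X -> Prop) a z :
  (forall u, S u -> S' (a *: u)) -> kos_deg i S z -> kos_deg i S' (a *: z : kos s).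
Proof.
move=> hS; elim: s i z => [|j s IH] [|i] z /=; first exact: hS.
- by move=> ->; rewrite scaler0.
- by move=> [/IH h ->]; split=> //; rewrite scaler0.
- by move=> [/IH h /IH h']; split.
Qed.

Lemma kos_bd_deg0 s S z : kos_deg 0 S z -> kos_bd z = 0 :> kos s.
Proof.
elim: s z => [|k s IH] z //=; case: z => z1 z2 /= [h ->].
by rewrite IH // kos_bd0 scaler0 addr0 oppr0.
Qed.

Lemma kos_deg_bd s i (S S' : X -> Prop) z : zclosed S' ->
    (forall j u, S u -> S' ('X_j *: u)) ->
  kos_deg i.+1 S z -> kos_deg i S' (kos_bd z : kos s).
Proof.
move=> hS' hX; elim: s i z => [|j s IH] i z /=.
  by move=> _; case: i => //; exact: hS'.1.
move=> [h1 h2]; split; first by apply: kos_degD => //; [apply: IH | apply: kos_degZ h2; apply: hX].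
case: i h2 {h1} => [|i] h2; last by apply: kos_degN => //; apply: IH.
by rewrite (kos_bd_deg0 h2) oppr0.
Qed.

End Complex.

Section Functoriality.
Variables (X Y : lmodType P0) (f : X -> Y).

Fixpoint kos_map (s : seq 'I_n) : kos X s -> kos Y s :=
  match s return kos X s -> kos Y s with
  | [::] => f
  | _ :: s' => fun z => (kos_map z.1, kos_map z.2)
  end.

Lemma kos_map0 s : f 0 = 0 -> kos_map (0 : kos X s) = 0.
Proof. by move=> f0; elim: s => [|i s IH] //=; rewrite IH. Qed.

Lemma kos_mapB s z w : {morph f : u v / u - v} ->
  kos_map (z - w) = kos_map z - kos_map w :> kos Y s.
Proof.
move=> fB; elim: s z w => [|i s IH] z w /=; first exact: fB.
rewrite -[LHS]/(kos_map (z.1 - w.1), kos_map (z.2 - w.2)).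
by rewrite !IH.
Qed.

Lemma kos_map_bd s z : linear f ->
  kos_map (kos_bd z) = kos_bd (kos_map z) :> kos Y s.
Proof.
move=> fl; pose F := GRing.isLinear.Build P0 X Y _ f fl.
pose g : {linear X -> Y} := HB.pack f F.
have mapP a t (u v : kos X t) : kos_map (a *: u + v) = a *: kos_map u + kos_map v.
  elim: t u v => [|i t IH] u v /=; first exact: fl.
  rewrite -[LHS]/(kos_map (a *: u.1 + v.1), kos_map (a *: u.2 + v.2)).
  by rewrite !IH.
elim: s z => [|i s IH] z /=; first exact: (linear0 g).
congr (_, _); first by rewrite addrC mapP IH addrC.
by rewrite -scaleN1r -[_ *: _]addr0 mapP kos_map0 ?addr0 ?scaleN1r ?IH //; exact: (linear0 g).
Qed.

Lemma kos_deg_map s i (S : X -> Prop) (S' : Y -> Prop) z : f 0 = 0 ->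
  (forall u, S u -> S' (f u)) -> kos_deg i S z -> kos_deg i S' (kos_map z : kos Y s).
Proof.
move=> f0 h; elim: s i z => [|j s IH] [|i] z /=; first exact: h.
- by move=> ->.
- by move=> [h1 ->]; split; [apply: IH | apply: kos_map0].
- by move=> [h1 h2]; split; apply: IH.
Qed.

Lemma kos_deg_lift s i (S : X -> Prop) (S' : Y -> Prop) z : f 0 = 0 ->
    (forall y, S' y -> exists2 u, S u & f u = y) -> kos_deg i S' z ->
  exists2 w : kos X s, kos_deg i S w & kos_map w = z.
Proof.
move=> f0 h; elim: s i z => [|j s IH] [|i] z /=; first exact: h.
- by move=> ->; exists 0.
- case: z => z1 z2 /= [/IH [w hw <-] ->].
  by exists (w, 0) => //=; rewrite kos_map0.
- case: z => z1 z2 /= [/IH [w hw <-] /IH [w' hw' <-]].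
  by exists (w, w').
Qed.

Lemma kos_deg_ker s i (S : X -> Prop) z : kos_deg i S z -> kos_map z = 0 :> kos Y s ->
  kos_deg i (fun u => S u /\ f u = 0) z.
Proof.
elim: s i z => [|j s IH] [|i] z //=.
- by move=> [h1 ->] [h2 _]; split=> //; apply: IH.
- by move=> [h1 h2] [h3 h4]; split; apply: IH.
Qed.

End Functoriality.

Lemma kos_deg_sub (X : lmodType P0) s i (S S' : X -> Prop) (z : kos X s) :
  (forall u, S u -> S' u) -> kos_deg i S z -> kos_deg i S' z.
Proof.
move=> h; elim: s i z => [|j s IH] [|i] z /=; first exact: h.
- by [].
- by move=> [h1 ->]; split=> //; apply: IH.
- by move=> [h1 h2]; split; apply: IH.
Qed.

End Koszul.

(** * Acyclicity of the Koszul complex by a de Rham homotopy *)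

Section Acyclicity.
Variables (K : fieldType) (n : nat).
Local Notation P0 := {mpoly K[n]}.

(** Vanishing of Koszul homology in one internal degree: the differential raises
    the degree of the components by 1, so S' is to be the component just below S. *)
Definition koszul_exact (X : lmodType P0) (S S' : X -> Prop) : Prop :=
  forall i (z : kos X (enum 'I_n)), kos_deg i S z -> kos_bd z = 0 ->
  exists2 w, kos_deg i.+1 S' w & kos_bd w = z.

Section Homotopy.
Hypothesis charK : [pchar K] =i pred0.
Variables (X : lmodType P0) (dX : 'I_n -> X -> X).
Hypothesis dXB : forall i, {morph dX i : u v / u - v}.
Hypothesis dXX : forall i j u, dX i ('X_j *: u) = u *+ (i == j) + 'X_j *: dX i u.

(** The de Rham differential: exterior multiplication by dx_i after derivation. *)
Fixpoint kos_h (s : seq 'I_n) : kos X s -> kos X s :=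
  match s return kos X s -> kos X s with
  | [::] => fun=> 0
  | i :: s' => fun z => (kos_h z.1, kos_map (dX i) z.1 - kos_h z.2)
  end.

Let dX0 i : dX i 0 = 0.
Proof. by rewrite -[0 in LHS](subrr 0) dXB subrr. Qed.

Let mapD i s (z w : kos X s) : kos_map (dX i) (z + w) = kos_map (dX i) z + kos_map (dX i) w.
Proof.
have mapN (u : kos X s) : kos_map (dX i) (- u) = - kos_map (dX i) u.
  by rewrite -sub0r kos_mapB ?kos_map0 ?sub0r.
by rewrite -[w in LHS]opprK kos_mapB // mapN opprK.
Qed.

Lemma kos_mapX i j s (z : kos X s) :
  kos_map (dX i) ('X_j *: z) = z *+ (i == j) + 'X_j *: kos_map (dX i) z.
Proof.
elim: s z => [|k s IH] z /=; first exact: dXX.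
rewrite -[LHS]/(kos_map (dX i) ('X_j *: z.1), kos_map (dX i) ('X_j *: z.2)) !IH.
by case: z => z1 z2 /=; case: (i == j).
Qed.

Lemma kos_map_bd_other i s (z : kos X s) : i \notin s ->
  kos_map (dX i) (kos_bd z) = kos_bd (kos_map (dX i) z).
Proof.
elim: s z => [|k s IH] z /=; first by move=> _; apply: dX0.
rewrite inE negb_or => /andP [/negPf ik is_].
by rewrite mapD kos_mapX ik mulr0n add0r !IH // -[- kos_bd z.2]sub0r kos_mapB //
  kos_map0 // sub0r IH.
Qed.

Lemma kos_h0 s : kos_h (0 : kos X s) = 0.
Proof. by elim: s => [|k s IH] //=; rewrite IH kos_map0 // subr0. Qed.

Lemma kos_hD s z w : kos_h (z + w) = kos_h z + kos_h w :> kos X s.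
Proof.
elim: s z w => [|k s IH] z w /=; first by rewrite addr0.
rewrite -[LHS]/(kos_h (z.1 + w.1), kos_map (dX k) (z.1 + w.1) - kos_h (z.2 + w.2)).
by rewrite !IH mapD opprD addrACA.
Qed.

Lemma kos_hN s z : kos_h (- z) = - kos_h z :> kos X s.
Proof. by apply/eqP; rewrite -addr_eq0 -kos_hD addNr kos_h0. Qed.

Lemma kos_hX s j (z : kos X s) : j \notin s -> kos_h ('X_j *: z) = 'X_j *: kos_h z.
Proof.
elim: s z => [|k s IH] z /=; first by rewrite scaler0.
rewrite inE negb_or eq_sym => /andP [/negPf jk js].
rewrite -[LHS]/(kos_h ('X_j *: z.1), kos_map (dX k) ('X_j *: z.1) - kos_h ('X_j *: z.2)).
by rewrite !IH // kos_mapX jk mulr0n add0r -scalerBr.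
Qed.

Lemma kos_map_cons s j (g : X -> X) (z : kos X s) :
  kos_map (fun u => 'X_j *: dX j u + g u) z = 'X_j *: kos_map (dX j) z + kos_map g z.
Proof.
by elim: s z => [|k s IH] z //=; rewrite !IH.
Qed.

Let regroup (V : zmodType) (a b c m e v w : V) : b + c = e + w ->
  - (a - b) + (a + (v + m) + c) = m + e + (v + w).
Proof.
move=> bc; rewrite opprB -!addrA addKr [e + _]addrCA -bc !(addrCA b).
by rewrite [RHS]addrCA.
Qed.

Lemma kos_map_mulrn (g : X -> X) (S : X -> Prop) e s i (z : kos X s) : S 0 ->
  (forall u, S u -> g u = u *+ e) -> kos_deg i S z -> kos_map g z = z *+ e.
Proof.
move=> S0 Sg; have pairMn s' (w w' : kos X s') : (w, w') *+ e = (w *+ e, w' *+ e).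
  by elim: (e) => // l eq; rewrite !mulrS eq.
have g0 : g 0 = 0 by rewrite Sg // mul0rn.
elim: s i z => [|j s IH] [|i] z /=; first exact: Sg.
- by move=> ->; rewrite g0 mul0rn.
- by case: z => z1 z2 [h /= ->]; rewrite pairMn (IH _ _ h) kos_map0 // mul0rn.
- by case: z => z1 z2 [h h']; rewrite pairMn /= (IH _ _ h) (IH _ _ h').
Qed.

(** Cartan's formula: the anticommutator of the Koszul and de Rham differentials is
    the Lie derivative along the Euler field, which on i-forms is the Euler operator
    on coefficients plus i. *)
Lemma kos_homotopy s (S : X -> Prop) i (z : kos X s) : uniq s -> kos_deg i S z ->
  kos_bd (kos_h z) + kos_h (kos_bd z) =
  kos_map (fun u => \sum_(j <- s) 'X_j *: dX j u) z + z *+ i.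
Proof.
elim: s i z => [|k s IH] i z /=.
  by move=> _; rewrite big_nil !add0r; case: i => [|i] // ->; rewrite mul0rn.
move=> /andP [ks us]; case: z => u v /= [hu hv].
have -> : (fun w => \sum_(j <- k :: s) 'X_j *: dX j w) =
   (fun w => 'X_k *: dX k w + \sum_(j <- s) 'X_j *: dX j w).
  by apply/funext => w; rewrite big_cons.
rewrite !kos_map_cons.
have {}IHu := IH i u us hu.
have {IH}hv' : - kos_bd (kos_map (dX k) u - kos_h v) +
     (kos_map (dX k) (kos_bd u + 'X_k *: v) - kos_h (- kos_bd v)) =
     'X_k *: kos_map (dX k) v + kos_map (fun w => \sum_(j <- s) 'X_j *: dX j w) v + v *+ i.
  rewrite kos_bdB kos_hN opprK mapD kos_mapX eqxx mulr1n kos_map_bd_other //.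
  case: i hv {hu IHu} => [|i] hv.
    have s0 : \sum_(j <- s) 'X_j *: dX j 0 = 0 by apply: big1_seq => j _; rewrite dX0 scaler0.
    rewrite hv kos_h0 !kos_bd0 !kos_map0 // kos_h0 !scaler0 !mul0rn !addr0 subr0.
    by rewrite addNr.
  by rewrite mulrS; apply: regroup; apply: (IH i v us hv).
rewrite -[LHS]/(kos_bd (kos_h u) + 'X_k *: (kos_map (dX k) u - kos_h v) +
   kos_h (kos_bd u + 'X_k *: v), - kos_bd (kos_map (dX k) u - kos_h v) +
     (kos_map (dX k) (kos_bd u + 'X_k *: v) - kos_h (- kos_bd v))) hv'.
have -> : (u, v) *+ i = (u *+ i, v *+ i) :> kos X (k :: s).
  by elim: (i) => [|l e] //; rewrite !mulrS e.
congr (_, _).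
rewrite -[RHS]/('X_k *: kos_map (dX k) u +
   kos_map (fun w => \sum_(j <- s) 'X_j *: dX j w) u + u *+ i).
rewrite -[RHS]addrA -IHu kos_hD kos_hX // scalerBr.
by rewrite addrACA subrK addrC.
Qed.

(** On components of degree e + 1 the homotopy of kos_homotopy yields
    multiplication by e + 1 + i, which is invertible in characteristic 0. *)
Lemma weyl_koszul_exact (F : nat -> X -> Prop) e :
    (forall e, zclosed (F e)) ->
    (forall e u (c : K), F e u -> F e (c%:MP *: u)) ->
    (forall e u i, F e.+1 u -> F e (dX i u)) ->
    (forall e u, F e u -> \sum_i 'X_i *: dX i u = u *+ e) ->
  koszul_exact (F e.+1) (F e).
Proof.
move=> FB FZ Fd FE i z hz bz.
pose c : P0 := (((e.+1 + i)%:R : K)^-1)%:MP.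
have hcz : kos_deg i (F e.+1) (c *: z) by apply: kos_degZ hz => u; apply: FZ.
have cK : (c *: z) *+ (e.+1 + i) = z.
  rewrite -scaler_nat scalerA /c -mpolyC_nat -rmorphM mulfV ?scale1r //.
  by apply: natf_neq0 => //; rewrite addSn.
exists (kos_h (c *: z)).
  have : forall s (w : kos X s), kos_deg i (F e.+1) w -> kos_deg i.+1 (F e) (kos_h w).
    move=> s; elim: s i {z hz bz c hcz cK} => [|j s IH] i w //= [h1 h2].
    case: w h1 h2 => w1 w2 /= h1 h2; split; first exact: IH.
    apply: kos_degB => //.
      by apply: kos_deg_map h1 => // u; apply: Fd.
    case: i h1 h2 => [|i] h1 h2; last exact: IH.
    by rewrite h2 kos_h0; apply: kos_deg0; apply: (FB e).1.
  by apply.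
have := kos_homotopy (enum_uniq 'I_n) hcz.
rewrite kos_bdZ bz scaler0 kos_h0 addr0 => ->.
rewrite -[RHS]cK mulrnDr; congr (_ + _).
apply: kos_map_mulrn hcz => [|u Fu]; first exact: (FB e.+1).1.
by rewrite -(FE _ _ Fu) big_enum.
Qed.

End Homotopy.
End Acyclicity.

(** * Regularity of kernels *)

Section KernelExactness.
Variables (K : fieldType) (n : nat).
Local Notation P0 := {mpoly K[n]}.

(** This is how regularity passes from a module to its syzygies. A cycle z of the
    kernel of f bounds a chain w over X; the image f w is a cycle, hence the
    boundary of a chain t, which lifts to t' over X because its components lie in
    the image of f. Then w - bd t' is a chain of the kernel with boundary z. Here
    F2, F1, F0 are consecutive components of X, and N1, N0 those of Y that f maps
    F1 and F0 to. *)
Lemma koszul_exact_kernel (X Y : lmodType P0) (f : X -> Y)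
    (F2 F1 F0 : X -> Prop) (N1 N0 : Y -> Prop) :
    linear f -> zclosed F1 ->
    (forall u i, F0 u -> F1 ('X_i *: u)) ->
    (forall u, F1 u -> N1 (f u)) ->
    (forall y, N0 y -> exists2 u, F0 u & f u = y) -> F0 0 ->
    koszul_exact F2 F1 -> koszul_exact N1 N0 ->
  koszul_exact (fun u => F2 u /\ f u = 0) (fun u => F1 u /\ f u = 0).
Proof.
move=> fl zF1 F0X FN NF F00 exF exN i z hz bz.
have f0 : f 0 = 0.
  by have := fl (-1) 0 0; rewrite scaler0 addr0 scaleN1r addNr.
have fB : {morph f : u v / u - v}.
  move=> u v; rewrite -scaleN1r [u + _]addrC fl scaleN1r addrC.
  by [].
have hz2 : kos_deg i F2 z by apply: kos_deg_sub hz => u [].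
have [w hw bw] := exF i z hz2 bz.
have fz : kos_map f z = 0.
  elim: (enum 'I_n) i z hz {bz hz2 w hw bw} => [|j s IH] [|i] z /=.
  - by case.
  - by move=> ->.
  - by case: z => z1 z2 /= [h ->]; rewrite (IH _ _ h) kos_map0.
  - by case: z => z1 z2 /= [h h']; rewrite (IH _ _ h) (IH _ _ h').
have hfw : kos_deg i.+1 N1 (kos_map f w) by apply: kos_deg_map hw.
have bfw : kos_bd (kos_map f w) = 0 by rewrite -kos_map_bd // bw.
have [t ht bt] := exN _ _ hfw bfw.
have [t' ht' ft'] := kos_deg_lift f0 NF ht.
exists (w - kos_bd t'); last by rewrite kos_bdB bw kos_bd_bd subr0.
apply: kos_deg_ker.
  apply: kos_degB => //; apply: kos_deg_bd ht' => // j u; exact: F0X.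
by rewrite kos_mapB // kos_map_bd // ft' bt subrr.
Qed.

(** Exactness in homological degree 0 says that S is generated by the x_i S'. *)
Lemma koszul_exact_generated (X : lmodType P0) (S S' T : X -> Prop) :
    koszul_exact S S' -> zclosed T -> (forall u i, S' u -> T ('X_i *: u)) ->
  forall u, S u -> T u.
Proof.
move=> ex zT TX u Su.
have [||w hw bw] := ex 0%N (kos_in0 (enum 'I_n) u).
- exact/kos_deg_in0.
- exact: kos_bd_in0.
apply/(kos_deg_in0 (enum 'I_n)); rewrite -bw.
by apply: kos_deg_bd hw => // i v; apply: TX.
Qed.

(** A space of vectors separated by the finitely many functionals l has a finite
    basis over K: take an independent family of maximal length. *)
Lemma finite_basis (Y : lmodType P0) (S : Y -> Prop) (J : finType) (l : J -> Y -> K) :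
    S 0 -> (forall (c : K) u v, S u -> S v -> S (c%:MP *: u + v)) ->
    (forall j (c : K) u v, l j (c%:MP *: u + v) = c * l j u + l j v) ->
    (forall u, S u -> (forall j, l j u = 0) -> u = 0) ->
  exists b (B : 'I_b -> Y), [/\ forall k, S (B k),
    forall c : 'I_b -> K, \sum_k (c k)%:MP *: B k = 0 -> forall k, c k = 0
    & forall y, S y -> exists c : 'I_b -> K, y = \sum_k (c k)%:MP *: B k].
Proof.
move=> S0 SP lP linj.
pose indep b (B : 'I_b -> Y) := (forall k, S (B k)) /\
  (forall c : 'I_b -> K, \sum_k (c k)%:MP *: B k = 0 -> forall k, c k = 0).
have l0 j : l j 0 = 0.
  have := lP j 1 0 0; rewrite scaler0 addr0 mul1r => e.
  by apply: (addrI (l j 0)); rewrite addr0 -e.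
have lsum b (c : 'I_b -> K) (B : 'I_b -> Y) j (r : seq 'I_b) :
    l j (\sum_(k <- r) (c k)%:MP *: B k) = \sum_(k <- r) c k * l j (B k).
  elim: r => [|k r IH]; first by rewrite !big_nil l0.
  by rewrite !big_cons lP IH.
have Ssum b (c : 'I_b -> K) (B : 'I_b -> Y) (r : seq 'I_b) :
    (forall k, S (B k)) -> S (\sum_(k <- r) (c k)%:MP *: B k).
  by move=> SB; elim/big_rec: _ => // k u _; apply: SP.
pose Q b := `[< exists B : 'I_b -> Y, indep b B >].
have Qle b : Q b -> (b <= #|J|)%N.
  move=> /asboolP [B [SB iB]].
  pose M : 'M[K]_(b, #|J|) := \matrix_(k, j) l (enum_val j) (B k).
  suff /eqP <- : row_free M by apply: rank_leq_col.
  rewrite -kermx_eq0; apply/eqP/row_matrixP => i; rewrite row0.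
  have : row i (kermx M) *m M = 0 by rewrite -row_mul mulmx_ker row0.
  set v := row i _ => vM; apply/rowP => k; rewrite [RHS]mxE.
  apply: (iB (fun k => v 0 k)); apply: linj => [|j]; first exact: Ssum.
  have vMj : (v *m M) 0 (enum_rank j) = 0 by rewrite vM mxE.
  rewrite lsum -[RHS]vMj [RHS]mxE; apply: eq_bigr => k' _.
  by rewrite [M _ _]mxE enum_rankK.
have Q0 : exists b, Q b.
  exists 0%N; apply/asboolP; exists (fun=> 0); split=> //.
  by move=> c _ [].
case: (ex_maxnP Q0 Qle) => b /asboolP [B [SB iB]] bmax.
exists b, B; split=> // y Sy.
case: (pselect (exists c : 'I_b -> K, y = \sum_k (c k)%:MP *: B k)) => // ny.
suff /bmax : Q b.+1 by rewrite ltnn.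
apply/asboolP; exists (fun k => if unlift ord0 k is Some k' then B k' else y).
split=> [k|c]; first by case: unlift.
rewrite big_ord_recl unlift_none => e.
rewrite (eq_bigr (fun k => (c (lift ord0 k))%:MP *: B k)) in e; last first.
  by move=> k _; rewrite liftK.
have c0 : c ord0 = 0.
  apply/eqP/negPn/negP => c0; apply: ny.
  exists (fun k => - (c ord0)^-1 * c (lift ord0 k)).
  have -> : y = ((c ord0)^-1)%:MP *: ((c ord0)%:MP *: y).
    by rewrite scalerA -mpolyCM mulVf // scale1r.
  move/eqP: e; rewrite addr_eq0 => /eqP ->; rewrite scalerN scaler_sumr -sumrN.
  by apply: eq_bigr => k _; rewrite scalerA -mpolyCM mulNr mpolyCN scaleNr.
move: e; rewrite c0 scale0r add0r => e k.
by case: (unliftP ord0 k) => [k' ->|->] //; apply: (iB _ e).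
Qed.

End KernelExactness.

(** * Modules with linear resolutions *)

Section LinearCover.
Variables (K : fieldType) (n : nat).
Hypothesis charK : [pchar K] =i pred0.
Local Notation P0 := {mpoly K[n]}.

Definition homrow b (e : nat) (v : 'rV[P0]_b) : Prop := forall k, hom e (v 0 k).

Definition comb (Y : lmodType P0) b (B : 'I_b -> Y) (v : 'rV[P0]_b) : Y :=
  \sum_k v 0 k *: B k.

Definition syzygy (Y : lmodType P0) b (B : 'I_b -> Y) (e : nat) (v : 'rV[P0]_b) : Prop :=
  homrow e v /\ comb B v = 0.

Lemma comb_is_linear (Y : lmodType P0) b (B : 'I_b -> Y) : linear (comb B).
Proof.
move=> a u v; rewrite /comb scaler_sumr -big_split; apply: eq_bigr => k _ /=.
by rewrite !mxE scalerDl scalerA.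
Qed.

Lemma homrow_zclosed b e : zclosed (@homrow b e).
Proof.
split=> [k|u v hu hv k]; rewrite !mxE; first exact: hom0.
by apply: homD => //; apply: homN.
Qed.

Lemma homrowZ b e f a (v : 'rV_b) : hom f a -> homrow e v -> homrow (f + e) (a *: v).
Proof. by move=> ha hv k; rewrite mxE; apply: homM. Qed.

Lemma homrowX b e i (v : 'rV_b) : homrow e v -> homrow e.+1 ('X_i *: v).
Proof. by apply: (@homrowZ b e 1); apply: homX. Qed.

Lemma homrowC b e (c : K) (v : 'rV_b) : homrow e v -> homrow e (c%:MP *: v).
Proof. by apply: (@homrowZ b e 0); apply: homC. Qed.

Lemma hom0E (p : P0) : hom 0 p -> p = (p@_0)%:MP.
Proof.
move=> hp; apply/mpolyP => k; rewrite mcoeffC.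
case: (eqVneq k 0%MM) => [->|k0]; first by rewrite mulr1.
rewrite mulr0; apply/eqP/negPn/negP => /hp /eqP.
by rewrite mdeg_eq0 (negPf k0).
Qed.

Lemma homrow_koszul_exact b e : koszul_exact (@homrow b e.+1) (@homrow b e).
Proof.
apply: (@weyl_koszul_exact K n charK _ (fun i => map_mx (mderiv i))).
- by move=> i u v; apply/rowP => k; rewrite !mxE mderivB.
- move=> i j u; apply/rowP => k; rewrite !mxE mderivM mderivXU mulr_natl.
  by case: (i == j); rewrite ?mxE.
- exact: homrow_zclosed.
- by move=> f u c; apply: homrowC.
- by move=> f u i hu k; rewrite mxE; apply: hom_mderiv.
- move=> f u hu; apply/rowP => k; rewrite summxE.
  rewrite (eq_bigr (fun i => 'X_i * (u 0 k)^`M(i))) ?(euler (hu k)).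
    by elim: (f) => [|l IH]; rewrite ?mxE // !mulrS mxE -IH.
  by move=> i _; rewrite !mxE.
Qed.

(** By Euler's formula a form a of degree f + 1 is a combination of the variables
    with coefficients the partial derivatives of a, divided by f + 1. *)
Lemma graded_homZ (Y : lmodType P0) (N : nat -> Y -> Prop) :
    (forall e, zclosed (N e)) ->
    (forall e u i, N e u -> N e.+1 ('X_i *: u)) ->
    (forall e u (c : K), N e u -> N e (c%:MP *: u)) ->
  forall e f a u, hom f a -> N e u -> N (e + f)%N (a *: u).
Proof.
move=> Nz NX NC e f; elim: f => [|f IH] a u ha hu.
  by rewrite addn0 (hom0E ha); apply: NC.
have -> : a = \sum_i 'X_i * ((f.+1%:R : K)^-1%:MP * a^`M(i)).
  rewrite (eq_bigr (fun i => (f.+1%:R : K)^-1%:MP * ('X_i * a^`M(i)))); last first.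
    by move=> i _; rewrite mulrCA.
  have cK : (f.+1%:R : K)^-1 *+ f.+1 = 1 by rewrite -[LHS]mulr_natr mulVf ?natf_neq0.
  by rewrite -mulr_sumr (euler ha) mulrnAr -mulrnAl -mpolyCMn cK mul1r.
rewrite scaler_suml addnS; apply: zclosed_sum => // i _.
rewrite -scalerA; apply: NX; apply: IH => //.
by apply: (@homM _ _ 0 f); [apply: homC | apply: hom_mderiv].
Qed.

(** N is q-regular: its Koszul homology vanishes beyond the linear strand. So
    N is generated by N_q from degree q on, and a K-basis B of N_q covers it
    minimally; by koszul_exact_kernel the syzygies of B, graded so that B has degree 0,
    are 1-regular and vanish in degree 0. The functionals l witness that N_q has finite
    dimension. *)
Lemma linear_cover (Y : lmodType P0) (N : nat -> Y -> Prop) q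
    (J : finType) (l : J -> Y -> K) :
    (forall e, zclosed (N e)) ->
    (forall e u i, N e u -> N e.+1 ('X_i *: u)) ->
    (forall e u (c : K), N e u -> N e (c%:MP *: u)) ->
    (forall j (c : K) u v, l j (c%:MP *: u + v) = c * l j u + l j v) ->
    (forall u, N q u -> (forall j, l j u = 0) -> u = 0) ->
    (forall e, (q <= e)%N -> koszul_exact (N e.+1) (N e)) ->
  exists b (B : 'I_b -> Y), [/\ forall k, N q (B k),
    forall v, syzygy B 0 v -> v = 0,
    forall e y, N (q + e)%N y -> exists2 v, homrow e v & comb B v = y
    & forall e, (1 <= e)%N -> koszul_exact (syzygy B e.+1) (syzygy B e)].
Proof.
move=> Nz NX NC lP linj ex.
have [||||b [B [BN Bi Bg]]] := @finite_basis K n Y (N q) J l.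
- exact: (Nz q).1.
- by move=> c u v hu hv; apply: zclosedD => //; apply: NC.
- exact: lP.
- exact: linj.
have gen e y : N (q + e)%N y -> exists2 v, homrow e v & comb B v = y.
  elim: e y => [|e IH] y.
    rewrite addn0 => /Bg [c ->]; exists (\row_k (c k)%:MP).
      by move=> k; rewrite mxE; apply: homC.
    by apply: eq_bigr => k _; rewrite mxE.
  rewrite addnS => hy.
  apply: (@koszul_exact_generated _ _ _ (N (q + e).+1) (N (q + e)%N)
    (fun y => exists2 v, homrow e.+1 v & comb B v = y)) hy.
  - by apply: ex; apply: leq_addr.
  - have zh := @homrow_zclosed b e.+1.
    split.
      exists 0; first exact: zh.1.
      by rewrite /comb big1 // => k _; rewrite mxE scale0r.
    move=> _ _ [u hu <-] [v hv <-]; exists (u - v); first exact: zh.2.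
    have -> : u - v = -1 *: v + u by rewrite scaleN1r addrC.
    by rewrite comb_is_linear scaleN1r addrC.
  - move=> u i /IH [v hv <-]; exists ('X_i *: v); first exact: homrowX.
    by rewrite /comb scaler_sumr; apply: eq_bigr => k _; rewrite mxE scalerA.
exists b, B; split=> //.
  move=> v [hv /= Bv].
  have vE k : v 0 k = ((v 0 k)@_0)%:MP by apply/hom0E/hv.
  apply/rowP => k; rewrite vE mxE.
  rewrite (Bi (fun k => (v 0 k)@_0)) ?mpolyC0 //.
  by rewrite -[RHS]Bv; apply: eq_bigr => k' _; rewrite -vE.
case=> // e _.
apply: (@koszul_exact_kernel K n 'rV[P0]_b Y (comb B) (homrow e.+2) (homrow e.+1)
  (homrow e) (N (q + e).+1) (N (q + e)%N)).
- exact: comb_is_linear.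
- exact: homrow_zclosed.
- by move=> u i; apply: homrowX.
- move=> u hu; apply: zclosed_sum => // k _; rewrite -addnS.
  exact: (graded_homZ Nz NX NC).
- exact: gen.
- exact: (homrow_zclosed b e).1.
- exact: homrow_koszul_exact.
- by apply: ex; apply: leq_addr.
Qed.

End LinearCover.

Section LinearResolution.
Variables (K : fieldType) (n : nat).
Hypothesis charK : [pchar K] =i pred0.
Local Notation P0 := {mpoly K[n]}.

Definition homog_part b e (v : 'rV[P0]_b) : 'rV_b := map_mx (pihomog mdeg e) v.

Lemma homrow_homog_part b e (v : 'rV_b) : homrow e (homog_part e v).
Proof. by move=> k; rewrite mxE; apply: hom_pihomog. Qed.

Lemma homog_part_sum b (v : 'rV_b) : exists N, v = \sum_(e < N) homog_part e v.
Proof.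
exists (\max_k msize (v 0%R k)); apply/rowP => k; rewrite summxE.
rewrite [LHS](@pihomog_partitionE _ _ mdeg (\max_k msize (v 0%R k))).
  by apply: eq_bigr => e _; rewrite mxE.
exact: (leq_bigmax k).
Qed.

(** What remains to be known about a homogeneous family B to resolve its syzygies
    linearly: they are a graded module, vanish in degree 0 and are 1-regular. *)
Definition graded_syzygies (Y : lmodType P0) b (B : 'I_b -> Y) : Prop :=
  [/\ forall v, comb B v = 0 -> forall e, comb B (homog_part e v) = 0,
    forall v, syzygy B 0 v -> v = 0
    & forall e, (1 <= e)%N -> koszul_exact (syzygy B e.+1) (syzygy B e)].

Lemma comb_row b c (M : 'M[P0]_(b, c)) v : comb (fun k => row k M) v = v *m M.
Proof. by rewrite /comb mulmx_sum_row. Qed.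

(** The minimal generators of the syzygies of B are linear, and they satisfy again
    what was assumed of B; this is linear_cover for the syzygies, in degree 1. *)
Lemma next_syzygies (Y : lmodType P0) b (B : 'I_b -> Y) : graded_syzygies B ->
  exists c (M : 'M[P0]_(c, b)), [/\ graded_syzygies (fun k => row k M),
    forall k l, hom 1 (M k l)
    & forall v, comb B v = 0 <-> exists w, v = w *m M].
Proof.
move=> [Bg B0 Bex].
have cl := @comb_is_linear K n Y b B.
have cB0 : comb B 0 = 0.
  by rewrite /comb big1 // => k _; rewrite mxE scale0r.
have cZ a v : comb B (a *: v) = a *: comb B v.
  by have := cl a v 0; rewrite !addr0 cB0 addr0.
have cD u v : comb B (u + v) = comb B u + comb B v.
  by have := cl 1 u v; rewrite !scale1r.
pose l (j : 'I_b * 'X_{1..n < 2}) (v : 'rV[P0]_b) := (v 0 j.1)@_(j.2).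
have [||||||c [R [RS Ri Rg Rex]]] := @linear_cover K n charK 'rV[P0]_b (syzygy B) 1 _ l.
- move=> e; split; first by split; [move=> k; rewrite mxE; apply: hom0 | apply: cB0].
  move=> u v [hu cu] [hv cv]; split; first exact: (@homrow_zclosed K n b e).2.
  by rewrite -scaleN1r cD cZ cu cv scaler0 addr0.
- by move=> e u i [hu cu]; split; [apply: homrowX | rewrite cZ cu scaler0].
- by move=> e u a [hu cu]; split; [apply: homrowC | rewrite cZ cu scaler0].
- by move=> j a u v; rewrite /l !mxE mcoeffD mcoeffCM.
- move=> u [hu _] lu; apply/rowP => k; rewrite mxE; apply/mpolyP => m; rewrite mcoeff0.
  apply/eqP/negPn/negP => um; have := hu k m um => m1.
  have m2 : (mdeg m < 2)%N by rewrite m1.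
  by case/eqP: um; have := lu (k, BMultinom m2).
- exact: Bex.
pose M : 'M[P0]_(c, b) := \matrix_k R k.
have rowM : (fun k => row k M) = R by apply/funext => k; rewrite rowK.
have combM w : w *m M = comb R w by rewrite -comb_row rowM.
have M1 k j : hom 1 (M k j) by rewrite mxE; apply: (RS k).1.
exists c, M; split=> //.
  rewrite rowM; split=> // v; rewrite -combM => vM e; rewrite -combM.
  apply/rowP => j; rewrite [RHS]mxE [LHS]mxE.
  have vMj : \sum_k v 0 k * M k j = 0.
    by have := congr1 (fun A : 'rV_b => A 0 j) vM; rewrite /= [LHS]mxE [RHS]mxE.
  transitivity (pihomog mdeg (e + 1) (\sum_k v 0 k * M k j)); last by rewrite vMj raddf0.
  rewrite (raddf_sum (pihomog mdeg (e + 1))).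
  by apply: eq_bigr => k _; rewrite mxE [RHS]pihomogM_hom.
move=> v; split; last first.
  move=> [w ->]; rewrite combM.
  suff cr (r : seq 'I_c) : comb B (\sum_(k <- r) w 0 k *: R k) = 0 by apply: cr.
  elim: r => [|k r IH]; first by rewrite big_nil.
  by rewrite big_cons cD cZ (RS k).2 scaler0 add0r.
move=> cv; have [N vN] := homog_part_sum v.
rewrite vN; elim/big_rec: _ => [|e u _ [w ->]]; first by exists 0; rewrite mul0mx.
case: {vN}(nat_of_ord e) => [|e'].
  rewrite (B0 (homog_part 0 v)) ?add0r; first by exists w.
  by split; [apply: homrow_homog_part | apply: Bg].
have [|w' _ w'E] := Rg e' (homog_part e'.+1 v).
  by split; [apply: homrow_homog_part | apply: Bg].
exists (w' + w); rewrite mulmxDl; congr (_ + _).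
by rewrite combM; apply/esym/w'E.
Qed.

(** One differential of the resolution. The successor stage is built so that its
    target is by computation the source of the given one, which makes composable
    matrices without casts. *)
Record syzygy_stage := SyzygyStage {
  st_src : nat; st_tgt : nat; st_mx : 'M[P0]_(st_src, st_tgt);
  st_good : graded_syzygies (fun k => row k st_mx);
  st_lin : forall k l, hom 1 (st_mx k l) }.

Lemma next_stage (s : syzygy_stage) : {c : nat & {M : 'M[P0]_(c, st_src s) |
  [/\ graded_syzygies (fun k : 'I_c => row k M),
      forall (k : 'I_c) (l : 'I_(st_src s)), hom 1 (M k l)
    & forall v : 'rV_(st_src s), v *m st_mx s = 0 <-> exists w : 'rV_c, v = w *m M]}}.
Proof.
have /cid [c hc] : exists c, exists M : 'M[P0]_(c, st_src s),
    [/\ graded_syzygies (fun k : 'I_c => row k M),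
      forall (k : 'I_c) (l : 'I_(st_src s)), hom 1 (M k l)
      & forall v : 'rV_(st_src s), v *m st_mx s = 0 <-> exists w : 'rV_c, v = w *m M].
  have [c [M [h1 h2 h3]]] := next_syzygies (st_good s).
  by exists c, M; split=> // v; rewrite -comb_row.
by exists c; apply: cid.
Qed.

Let next_mx (s : syzygy_stage) : 'M[P0]_(projT1 (next_stage s), st_src s) :=
  sval (projT2 (next_stage s)).

Let next_good (s : syzygy_stage) :
  graded_syzygies (fun k : 'I_(projT1 (next_stage s)) => row k (next_mx s)).
Proof. by rewrite /next_mx; case: (svalP (projT2 (next_stage s))). Qed.

Let next_lin (s : syzygy_stage) (k : 'I_(projT1 (next_stage s))) (l : 'I_(st_src s)) :
  hom 1 (next_mx s k l).
Proof. by move: k l; rewrite /next_mx; case: (svalP (projT2 (next_stage s))). Qed.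

Let succ_stage (s : syzygy_stage) : syzygy_stage :=
  SyzygyStage (@next_good s) (@next_lin s).

Lemma linear_resolution (Y : lmodType P0) b0 (B : 'I_b0 -> Y) : graded_syzygies B ->
  exists (b : nat -> nat) (e : b 0%N = b0) (D : forall p, 'M[P0]_(b p.+1, b p)),
  [/\ forall p k l, hom 1 (D p k l),
    forall v, comb (fun k => B (cast_ord e k)) v = 0 <-> exists w, v = w *m D 0%N
    & forall p (v : 'rV_(b p.+1)), v *m D p = 0 <-> exists w, v = w *m D p.+1].
Proof.
move=> gB; have [c [M [h1 h2 h3]]] := next_syzygies gB.
pose st := fix st p := if p is p'.+1 then succ_stage (st p') else SyzygyStage h1 h2.
exists (fun p => st_tgt (st p)), erefl, (fun p => st_mx (st p)); split.
- by move=> p; apply: st_lin.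
- move=> v; rewrite -h3; have -> // : (fun k => B (cast_ord erefl k)) = B.
  by apply/funext => k; rewrite cast_ord_id.
- by move=> p v; case: (svalP (projT2 (next_stage (st p)))) => _ _ /(_ v).
Qed.

End LinearResolution.

(** * The kernel of the r-th power of the polarization *)

Lemma iter_shift (T : Type) (f : T -> T) (g : nat -> T -> T) k e x :
  (forall e x, f (g e x) = g e.+1 (f x)) -> iter k f (g e x) = g (e + k)%N (iter k f x).
Proof. by move=> fg; elim: k => [|k IH]; rewrite ?addn0 // !iterS IH fg addnS. Qed.

Section PolarKernel.
Variables (K : fieldType) (n : nat).
Hypothesis charK : [pchar K] =i pred0.
Local Notation P0 := {mpoly K[n]}.
Local Notation P := {mpoly {mpoly K[n]}[n]}.
Variable (lam : 'I_n -> K).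
Hypothesis lam0 : forall i, lam i != 0.
Variables (r d : nat).
Local Notation D := (polar lam).

Definition polar_kernel (e : nat) (G : P) : Prop :=
  bihom e (d + r) G /\ iter r D G = 0.

Lemma iter_polar_linear : linear (iter r D : P -> P).
Proof. by move=> a u v; elim: r => // m IH; rewrite !iterS IH linearP. Qed.

Lemma bihom_zclosed e f : zclosed (X := P) (bihom e f).
Proof. by split=> [|u v hu hv]; [apply: bihom0 | apply: bihomD => //; apply: bihomN]. Qed.

Lemma bihomX e f i (u : P) : bihom e f u -> bihom e.+1 f ('X_i *: u).
Proof. by apply: (@bihomZ _ _ _ 1); apply: homX. Qed.

Lemma bihomC e f (c : K) (u : P) : bihom e f u -> bihom e f (c%:MP *: u).
Proof. by apply: (@bihomZ _ _ _ 0); apply: homC. Qed.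

Lemma bihom_koszul_exact e f :
  koszul_exact (X := P) (bihom e.+1 f) (bihom e f).
Proof.
apply: (@weyl_koszul_exact K n charK P (@dx K n) _ _ (fun e => bihom e f)).
- by move=> i u v; rewrite raddfB.
- by move=> i j u; rewrite dxZ mderivXU scaler_nat.
- by move=> e'; apply: bihom_zclosed.
- by move=> e' u c; apply: bihomC.
- by move=> e' u i; apply: bihom_dx.
- by move=> e' u; apply: euler_x.
Qed.

(** D^r maps z-degree d + r to z-degree d, both Koszul-acyclic, and it is onto in
    source x-degrees >= d; koszul_exact_kernel needs this one degree below e. *)
Lemma polar_kernel_koszul_exact e : (d < e)%N ->
  koszul_exact (polar_kernel e.+1) (polar_kernel e).
Proof.
case: e => // e de.
apply: (@koszul_exact_kernel K n P P (iter r D) _ _ (bihom e (d + r))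
  (bihom (e + r).+1 d) (bihom (e + r) d)).
- exact: iter_polar_linear.
- exact: bihom_zclosed.
- by move=> u i; apply: bihomX.
- by move=> u; rewrite -addSn; apply: bihom_iter_polar.
- move=> y hy; have [u hu ->] := iter_polar_surjective charK lam0 hy de.
  by exists u.
- exact: bihom0.
- exact: bihom_koszul_exact.
- exact: bihom_koszul_exact.
Qed.

(** The kernel is (d + 1)-regular, so linear_cover applies. *)
Lemma polar_kernel_generators : exists b (B : 'I_b -> P),
  [/\ forall k, polar_kernel d.+1 (B k),
     forall e G, polar_kernel (d.+1 + e) G -> exists v, comb B v = G
   & graded_syzygies B].
Proof.
have il := iter_polar_linear.
have iB := iter_raddfB D r.
have iZ a u : iter r D (a *: u) = a *: iter r D u.
  by have := il a u 0; rewrite iter_raddf0 !addr0.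
pose l (j : 'X_{1..n < (d + r).+1} * 'X_{1..n < d.+2}) (G : P) := G@_(j.1)@_(j.2).
have [||||||b [B [BN B0 Bg Bex]]] := @linear_cover K n charK P polar_kernel d.+1 _ l.
- move=> e; split; first by split; [apply: bihom0 | apply: iter_raddf0].
  move=> u v [hu du] [hv dv]; split; first exact: (bihom_zclosed e (d + r)).2.
  by rewrite iB du dv subrr.
- by move=> e u i [hu du]; split; [apply: bihomX | rewrite iZ du scaler0].
- by move=> e u c [hu du]; split; [apply: bihomC | rewrite iZ du scaler0].
- by move=> j c u v; rewrite /l !mcoeffD mcoeffZ mcoeffCM.
- move=> u [hu _] lu; apply/mpolyP => m; apply/mpolyP => k; rewrite !mcoeff0.
  apply/eqP/negPn/negP => umk; have [md ke] := hu m k umk.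
  have m2 : (mdeg m < (d + r).+1)%N by rewrite md.
  have k2 : (mdeg k < d.+2)%N by rewrite ke.
  by case/eqP: umk; have := lu (BMultinom m2, BMultinom k2).
- by move=> e de; apply: polar_kernel_koszul_exact.
exists b, B; split=> //.
  by move=> e G /Bg [v _ vG]; exists v.
split=> // v Bv e; apply/mpolyP => m; rewrite mcoeff0.
have vBm : \sum_k v 0 k * (B k)@_m = 0.
  transitivity ((comb B v)@_m); last by rewrite Bv mcoeff0.
  rewrite /comb (raddf_sum (mcoeff m)).
  by apply: eq_bigr => k _; rewrite /= mcoeffZ.
transitivity (pihomog mdeg (e + d.+1) (\sum_k v 0 k * (B k)@_m)); last by rewrite vBm raddf0.
rewrite /comb (raddf_sum (mcoeff m)) (raddf_sum (pihomog mdeg (e + d.+1))).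
apply: eq_bigr => k _; rewrite /= mcoeffZ mxE [RHS]pihomogM_hom //.
by have /bihomE [_] := (BN k).1; apply.
Qed.

Definition xpart (e : nat) : P -> P := map_mpoly (pihomog mdeg e).

Lemma mcoeff_xpart e G m : (xpart e G)@_m = pihomog mdeg e G@_m.
Proof. exact: mcoeff_map_mpoly. Qed.

Let pihomog_sum e (I : finType) (f : I -> P0) :
  pihomog mdeg e (\sum_i f i) = \sum_i pihomog mdeg e (f i).
Proof. exact: (raddf_sum (pihomog mdeg e)). Qed.

Lemma polar_xpart e G : D (xpart e G) = xpart e.+1 (D G).
Proof.
apply/mpolyP => m; rewrite mcoeff_polar mcoeff_xpart mcoeff_polar pihomog_sum.
apply: eq_bigr => i _; rewrite mcoeff_xpart.
rewrite -(pihomogMn mdeg e) mulrC [in RHS]mulrC.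
have := @pihomogM_hom K n e 1 (G@_(m + U_(i)) *+ (m i).+1) (lam i *: 'X_i); rewrite addn1 => -> //.
by rewrite -mul_mpolyC; apply: (@homM _ _ 0 1); [apply: homC | apply: homX].
Qed.

Lemma iter_polar_xpart k e G : iter k D (xpart e G) = xpart (e + k) (iter k D G).
Proof. exact: (@iter_shift P (polar lam) xpart k e G polar_xpart). Qed.

Lemma xpart0 e : xpart e 0 = 0.
Proof. exact: (raddf0 (map_mpoly (pihomog mdeg e))). Qed.

(** D^r commutes with taking x-homogeneous parts, so G splits into parts killed by
    D^r; those of x-degree at most d vanish because D^r is injective there. *)
Lemma polar_kernel_span b (B : 'I_b -> P) :
    (forall e G, polar_kernel (d.+1 + e) G -> exists v, comb B v = G) ->
  forall G, (forall m, G@_m != 0 -> mdeg m = (d + r)%N) -> iter r D G = 0 ->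
  exists v, comb B v = G.
Proof.
move=> Bg G Gd DG.
have Ge e : exists v, comb B v = xpart e G.
  have bG : bihom e (d + r) (xpart e G).
    apply/bihomE; split=> m; rewrite mcoeff_xpart; last exact: hom_pihomog.
    by move=> h; apply: Gd; apply: contraNneq h => ->; rewrite raddf0.
  have DGe : iter r D (xpart e G) = 0.
    by rewrite iter_polar_xpart DG; apply: xpart0.
  case: (leqP e d) => ed.
    have -> := iter_polar_injective charK lam0 bG ed DGe.
    by exists 0; rewrite /comb big1 // => k _; rewrite mxE scale0r.
  by apply: (Bg (e - d.+1)%N); rewrite subnKC.
have [N ->] : exists N, G = \sum_(e < N) xpart e G.
  exists (\max_(m <- msupp G) msize G@_m); apply/mpolyP => m.
  rewrite (raddf_sum (mcoeff m)) /=.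
  rewrite (eq_bigr (fun e : 'I_(\max_(m <- msupp G) msize G@_m) => pihomog mdeg e G@_m));
    last by move=> e _; rewrite mcoeff_xpart.
  case: (boolP (m \in msupp G)) => mG.
    by apply: pihomog_partitionE; rewrite (bigD1_seq m mG (msupp_uniq G)) leq_maxl.
  by rewrite (memN_msupp_eq0 mG) big1 // => e _; rewrite raddf0.
elim/big_rec: _ => [|e u _ [w wu]].
  by exists 0; rewrite /comb big1 // => k _; rewrite mxE scale0r.
have [v vE] := Ge e; exists (v + w).
by have := @comb_is_linear K n P b B 1 v w; rewrite !scale1r wu vE.
Qed.

End PolarKernel.

(** * Ideals generated by powers of the variables *)

Section PowerIdeal.
Variables (R : comNzRingType) (n : nat).
Implicit Types (p : {mpoly R[n]}) (m : 'X_{1..n}).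

(** Each monomial of p is assigned to one variable whose k-th power divides it. The
    quotients only have coefficients of p, which transfers homogeneity to them. *)
Lemma power_ideal_split (Q : pred 'I_n) k p :
    (forall m, p@_m != 0 -> exists2 i, Q i & (k <= m i)%N) ->
  exists q : 'I_n -> {mpoly R[n]}, [/\ p = \sum_i 'X_i ^+ k * q i,
    forall i, ~~ Q i -> q i = 0
    & forall i m, (q i)@_m = 0 \/ (q i)@_m = p@_(m + U_(i) *+ k)].
Proof.
move=> pQ; pose i0 m := [pick i | Q i && (k <= m i)%N].
pose q i := \sum_(m <- msupp p | i0 m == Some i) p@_m *: 'X_[m - U_(i) *+ k].
have i0P m i : i0 m = Some i -> Q i /\ (U_(i) *+ k <= m)%MM.
  rewrite /i0; case: pickP => // j /andP [Qj kj] [<-]; split=> //.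
  apply/mnm_lepP => l; rewrite mulmnE mnm1E; case: eqP => [<-|_]; last by rewrite mul0n.
  by rewrite mul1n.
exists q; split.
- rewrite [LHS]mpolyE.
  have -> : \sum_i 'X_i ^+ k * q i =
      \sum_i \sum_(m <- msupp p | i0 m == Some i) p@_m *: 'X_[m].
    apply: eq_bigr => i _; rewrite /q mulr_sumr; apply: eq_bigr => m /eqP /i0P [_ le].
    by rewrite -scalerAr mpolyXn -mpolyXD addmC submK.
  rewrite (exchange_big_dep xpredT) //= big_seq [RHS]big_seq; apply: eq_bigr => m.
  rewrite mcoeff_msupp => /pQ [i Qi ki].
  case E: (i0 m) => [j|].
    by rewrite (eq_bigl (pred1 j)) ?big_pred1_eq.
  by move: E; rewrite /i0; case: pickP => // /(_ i); rewrite Qi ki.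
- move=> i nQ; rewrite /q big_pred0 // => m; apply/negP => /eqP /i0P [Qi _].
  by rewrite Qi in nQ.
move=> i m; pose m' := (m + U_(i) *+ k)%MM.
have qE : (q i)@_m = \sum_(l <- msupp p | i0 l == Some i) p@_l * (l == m')%:R.
  rewrite /q raddf_sum; apply: eq_bigr => l /eqP /i0P [_ le] /=.
  rewrite mcoeffZ mcoeffX; have -> // : (l == m') = (l - U_(i) *+ k == m)%MM.
  by rewrite -{1}(submK le) eqm_add2r.
case: (boolP ((m' \in msupp p) && (i0 m' == Some i))) => [/andP [mp im]|h].
  right; rewrite qE big_mkcond (bigD1_seq m') //= im eqxx mulr1 big1 ?addr0 //.
  by move=> l /negPf ->; rewrite mulr0 if_same.
left; rewrite qE big1_seq // => l /andP [il lp].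
case: eqP => [e|_]; last by rewrite mulr0.
by move: h; rewrite -e lp il.
Qed.

Lemma mcoeffXkM i k p m :
  ('X_i ^+ k * p)@_m = if (k <= m i)%N then p@_(m - U_(i) *+ k) else 0.
Proof.
rewrite mpolyXn mcoeffXM; congr (if _ then _ else _).
apply/mnm_lepP/idP => [/(_ i)|ki l]; rewrite mulmnE mnm1E ?eqxx ?mul1n //.
by case: eqP => [<-|_]; rewrite ?mul1n.
Qed.

(** The powers of the variables form a regular sequence, so their relations are
    generated by the trivial ones. The induction removes the last variable that
    occurs: its coefficient lies in the ideal of the earlier powers. *)
Lemma koszul_relations k (p : 'I_n -> {mpoly R[n]}) :
    \sum_i 'X_i ^+ k * p i = 0 ->
  exists a : 'I_n -> 'I_n -> {mpoly R[n]},
    [/\ forall i j, a i j = - a j i, forall i, a i i = 0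
      & forall i, p i = \sum_j a i j * 'X_j ^+ k].
Proof.
have : forall M (p : 'I_n -> {mpoly R[n]}), (forall i : 'I_n, (M <= i)%N -> p i = 0) ->
    \sum_i 'X_i ^+ k * p i = 0 ->
  exists a : 'I_n -> 'I_n -> {mpoly R[n]},
    [/\ forall i j, a i j = - a j i, forall i, a i i = 0
      & forall i, p i = \sum_j a i j * 'X_j ^+ k].
  elim=> [|M IH] {}p pM sp.
    exists (fun _ _ => 0); split=> // [i j|i]; first by rewrite oppr0.
    by rewrite big1 ?pM // => j _; rewrite mul0r.
  case: (ltnP M n) => Mn; last first.
    apply: IH sp => i Mi; apply: pM; rewrite ltn_neqAle Mi andbT.
    by apply/eqP => e; move: (ltn_ord i); rewrite -e ltnNge Mn.
  pose i0 := Ordinal Mn.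
  have sp' : 'X_i0 ^+ k * p i0 = - \sum_(i < n | i != i0) 'X_i ^+ k * p i.
    by apply/eqP; rewrite -addr_eq0; move: sp; rewrite (bigD1 i0) //= => ->.
  have [m pm|q [qE q0 _]] := @power_ideal_split (fun i => (i < M)%N) k (p i0).
    have : ('X_i0 ^+ k * p i0)@_(m + U_(i0) *+ k) != 0.
      by rewrite mcoeffXkM mnmDE mulmnE mnm1E eqxx mul1n leq_addl addmK.
    rewrite sp' mcoeffN oppr_eq0 raddf_sum /= => h.
    have [i /andP [ii0 hi]] : exists i, (i != i0) && (('X_i ^+ k * p i)@_(m + U_(i0) *+ k) != 0).
      apply/existsP; apply: contraNT h => /existsPn h; rewrite big1 // => i ii0.
      by have := h i; rewrite ii0 /= negbK => /eqP.
    move: hi; rewrite mcoeffXkM mnmDE mulmnE mnm1E [i0 == i]eq_sym (negPf ii0) mul0n addn0.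
    case: ifP => [ki hi|]; last by rewrite eqxx.
    exists i => //; rewrite ltnNge; apply/negP => Mi.
    case/eqP: hi; rewrite pM ?mcoeff0 // ltn_neqAle Mi andbT eq_sym.
    by move: ii0; apply: contraNneq => e; apply/eqP/val_inj.
  pose p' i := if i == i0 then 0 else p i + 'X_i0 ^+ k * q i.
  have qi0 : q i0 = 0 by apply: q0; rewrite /= ltnn.
  have [||a [a1 a2 a3]] := IH p'.
  - move=> i; rewrite leq_eqVlt /p'; case: (eqVneq i i0) => // ii0 /orP [/eqP e|Mi].
      by case/eqP: ii0; apply/val_inj.
    by rewrite (pM i Mi) (q0 i) ?mulr0 ?addr0 // -leqNgt ltnW.
  - rewrite (bigD1 i0) //= /p' eqxx mulr0 add0r.
    rewrite (eq_bigr (fun i => 'X_i ^+ k * p i + 'X_i0 ^+ k * ('X_i ^+ k * q i))); last first.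
      by move=> i /negPf ->; rewrite mulrDr [in LHS]mulrCA.
    rewrite big_split /= -mulr_sumr -[X in X + _]opprK -sp' qE [in X in - X](bigD1 i0) //=.
    by rewrite qi0 mulr0 add0r addNr.
  exists (fun i j => a i j - q i *+ (j == i0) + q j *+ (i == i0)); split.
  - move=> i j; rewrite [a i j]a1 !opprD opprK -!addrA; congr (_ + _).
    by rewrite addrC.
  - by move=> i; rewrite a2 sub0r addNr.
  move=> i.
  have -> : \sum_j (a i j - q i *+ (j == i0) + q j *+ (i == i0)) * 'X_j ^+ k =
     p' i - q i * 'X_i0 ^+ k + (\sum_j q j * 'X_j ^+ k) *+ (i == i0).
    rewrite a3 -sumrMnl.
    have -> : q i * 'X_i0 ^+ k = \sum_j q i *+ (j == i0) * 'X_j ^+ k.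
      rewrite (bigD1 i0) //= eqxx mulr1n big1 ?addr0 // => j /negPf ->.
      by rewrite mul0r.
    rewrite -sumrB -big_split; apply: eq_bigr => j _ /=.
    by rewrite mulrDl mulrBl !mulrnAl.
  rewrite /p'; case: eqP => [->|_].
    rewrite qi0 mul0r subr0 add0r mulr1n {1}qE.
    by apply: eq_bigr => j _; rewrite mulrC.
  by rewrite mulr0n addr0 mulrC addrK.
by move=> h sp; apply: (h n) => // i; rewrite leqNgt ltn_ord.
Qed.
End PowerIdeal.

(** * Inverse polynomials as polynomials in z *)

Section Dual.
Variables (K : fieldType) (n : nat).
Hypothesis charK : [pchar K] =i pred0.
Local Notation P0 := {mpoly K[n]}.
Local Notation P := {mpoly {mpoly K[n]}[n]}.
Implicit Types (c m : 'X_{1..n}) (g G : P).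

Definition inv_fact c : K := \prod_(i < n) ((c i)`!%:R)^-1.

Definition in_box k c : bool := [forall i : 'I_n, (c i < k)%N].

Definition box_opp k c : 'X_{1..n} := [multinom (k.-1 - c i)%N | i < n].

(** The class of g / (y_1 ... y_n)^k in the top local cohomology of P is determined
    by the coefficients of the y^(-1-c). Sending y^(-1-c) to z^c / c! makes y_i act as
    d/dz_i (dual_XM). *)
Definition dual_coeff k g c : P0 :=
  if in_box k c then (inv_fact c)%:MP * g@_(box_opp k c) else 0.

Definition dual k g : P :=
  \sum_(c : 'X_{1..n < (n * k).+1}) dual_coeff k g c *: 'X_[c].

Lemma inv_fact_neq0 c : inv_fact c != 0.
Proof.
apply/prodf_neq0 => i _ /=.
by rewrite invr_eq0 natf_neq0 // -lt0n fact_gt0.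
Qed.

Lemma mdeg_in_box k c : in_box k c -> (mdeg c < (n * k).+1)%N.
Proof.
move=> /forallP h; rewrite ltnS mdegE.
apply: (@leq_trans (\sum_(i < n) k)); first by apply: leq_sum => i _; apply: ltnW.
by rewrite sum_nat_const card_ord.
Qed.

Lemma mcoeff_dual k g c : (dual k g)@_c = dual_coeff k g c.
Proof.
case: (ltnP (mdeg c) (n * k).+1) => h; first exact: (mcoeff_mpoly (dual_coeff k g)).
rewrite /dual raddf_sum big1 /= => [|l _].
  by rewrite /dual_coeff; case: ifP => // /mdeg_in_box; rewrite ltnNge h.
rewrite mcoeffZ mcoeffX; case: eqP => [e|_]; last by rewrite mulr0.
by move: h; rewrite -e leqNgt bmdeg.
Qed.

Lemma in_box_opp k c : in_box k c -> in_box k (box_opp k c).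
Proof.
move=> /forallP h; apply/forallP => i; rewrite mnmE; have := h i.
by lia.
Qed.

Lemma box_oppK k c : in_box k c -> box_opp k (box_opp k c) = c.
Proof. by move=> /forallP h; apply/mnmP => i; rewrite !mnmE; have := h i; lia. Qed.

Lemma dual_is_linear k : linear (dual k).
Proof.
move=> a g h; apply/mpolyP => c.
rewrite mcoeffD mcoeffZ !mcoeff_dual /dual_coeff; case: ifP => _; last by rewrite mulr0 addr0.
by rewrite mcoeffD mcoeffZ mulrDr mulrCA.
Qed.

HB.instance Definition _ k := GRing.isLinear.Build P0 P P _ (dual k) (dual_is_linear k).

Lemma inv_factU c i : inv_fact c = inv_fact (c + U_(i)) *+ (c i).+1.
Proof.
rewrite /inv_fact (bigD1 i) //= [in RHS](bigD1 i) //= -mulrnAl; congr (_ * _).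
  rewrite mnmDE mnm1E eqxx addn1 factS natrM invfM.
  rewrite -[RHS]mulr_natl mulrA divff ?mul1r //.
  exact: natf_neq0.
by apply: eq_bigr => j /negPf ji; rewrite mnmDE mnm1E eq_sym ji addn0.
Qed.

Lemma dual_XM k i g : dual k ('X_i * g) = (dual k g)^`M(i).
Proof.
apply/mpolyP => c; rewrite mcoeff_mderiv !mcoeff_dual /dual_coeff mcoeffXUM.
have -> : in_box k (c + U_(i)) = in_box k c && (box_opp k c i != 0%N).
  rewrite mnmE; apply/forallP/andP => [h|[/forallP h ki] j].
    split; first by apply/forallP => j; have := h j; rewrite mnmDE; lia.
    by have := h i; rewrite mnmDE mnm1E eqxx; lia.
  rewrite mnmDE mnm1E; have := h j; case: eqP => [<-|_]; lia.
case: ifP => //= kc; last by rewrite mul0rn.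
case: eqP => //= _; first by rewrite mulr0 mul0rn.
have -> : (box_opp k c - U_(i))%MM = box_opp k (c + U_(i)).
  by apply/mnmP => j; rewrite !mnmE; case: eqP => _; lia.
by rewrite -mulrnAl -mpolyCMn -inv_factU.
Qed.

Lemma dual_eq0_split k g : dual k g = 0 ->
  exists q : 'I_n -> P, g = \sum_i 'X_i ^+ k * q i /\
    forall i m, (q i)@_m = 0 \/ (q i)@_m = g@_(m + U_(i) *+ k).
Proof.
move=> g0; have [m|q [gE _ qg]] := @power_ideal_split _ n xpredT k g; last by exists q.
case: (boolP (in_box k m)) => [km|/forallPn [i]]; last by rewrite -leqNgt; exists i.
have : (dual k g)@_(box_opp k m) = 0 by rewrite g0 mcoeff0.
rewrite mcoeff_dual /dual_coeff in_box_opp // box_oppK // mul_mpolyC.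
move=> /(congr1 (fun p => (inv_fact (box_opp k m))^-1 *: p)).
by rewrite scaler0 scalerA mulVf ?inv_fact_neq0 // scale1r => ->; rewrite eqxx.
Qed.

Lemma dual_power_ideal k (q : 'I_n -> P) : dual k (\sum_i 'X_i ^+ k * q i) = 0.
Proof.
apply/mpolyP => c; rewrite mcoeff_dual /dual_coeff mcoeff0.
case: ifP => // /forallP kc; rewrite raddf_sum big1 ?mulr0 //= => i _.
rewrite mcoeffXkM mnmE; case: ifP => //; have := kc i; lia.
Qed.

(** The value depends only on the fraction g / (y_1 ... y_n)^k. *)
Lemma dual_shift k t g : dual (k + t) ('X_[[multinom t | _ < n]] * g) = dual k g.
Proof.
apply/mpolyP => c; rewrite !mcoeff_dual /dual_coeff mcoeffXM.
have -> : in_box k c = in_box (k + t) c && ([multinom t | _ < n] <= box_opp (k + t) c)%MM.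
  apply/forallP/andP => [h|[/forallP h /mnm_lepP h'] i].
    split; first by apply/forallP => i; have := h i; lia.
    by apply/mnm_lepP => i; rewrite !mnmE; have := h i; lia.
  by have := h i; have := h' i; rewrite !mnmE; lia.
case: ifP => //= _; case: ifP => /= [_|]; last by rewrite mulr0.
have -> // : (box_opp (k + t) c - [multinom t | _ < n])%MM = box_opp k c.
by apply/mnmP => i; rewrite !mnmE; lia.
Qed.

Lemma dual_f_lambda k (lam : 'rV[K]_n) g :
  dual k (f_lambda lam * g) = polar (lam 0) (dual k g).
Proof.
rewrite /f_lambda mulr_suml raddf_sum; apply: eq_bigr => i _.
rewrite /= -dual_XM -mulrA mul_mpolyC; exact: linearZ.
Qed.

Lemma dual_f_lambdaX k (lam : 'rV[K]_n) r g :
  dual k (f_lambda lam ^+ r * g) = iter r (polar (lam 0)) (dual k g).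
Proof.
elim: r => [|r IH]; first by rewrite mul1r.
by rewrite exprS -mulrA dual_f_lambda IH.
Qed.

Lemma mdeg_box_opp k c : in_box k c -> (mdeg (box_opp k c) + mdeg c + n = n * k)%N.
Proof.
move=> /forallP h; rewrite !mdegE -big_split /=.
rewrite (eq_bigr (fun=> k.-1)) => [|i _]; last by rewrite mnmE; have := h i; lia.
rewrite sum_nat_const card_ord; case: k h => [|k] h; last by rewrite mulnS addnC.
case: (posnP n) => [-> //|n0]; by have := h (Ordinal n0).
Qed.

Lemma dual_preimage k G e D : bihom e D G -> (D < k)%N ->
  exists2 g, dual k g = G & bihom e (n * k.-1 - D) g.
Proof.
move=> hG Dk; have [h1 h2] := proj1 (bihomE _ _ _) hG.
pose co c := if in_box k c then (inv_fact (box_opp k c))^-1%:MP * G@_(box_opp k c) else 0.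
pose g : P := \sum_(c : 'X_{1..n < (n * k).+1}) co c *: 'X_[c].
have gE c : in_box k c -> g@_c = co c.
  by move=> /mdeg_in_box h; apply: (mcoeff_mpoly co).
exists g.
  apply/mpolyP => c; rewrite mcoeff_dual /dual_coeff; case: ifP => kc.
    rewrite gE ?in_box_opp // /co in_box_opp // box_oppK // mulrA -mpolyCM.
    by rewrite mulfV ?mul1r // inv_fact_neq0.
  apply/esym/eqP/negPn/negP => /h1 cD; move/negP: kc; apply; apply/forallP => i.
  by apply: leq_trans Dk; rewrite ltnS -cD mdegE (bigD1 i) //= leq_addr.
apply/bihomE; split=> c.
  case: (boolP (in_box k c)) => kc.
    rewrite gE // /co kc => h; have cD : mdeg (box_opp k c) = D.
      by apply: h1; apply: contraNneq h => ->; rewrite mulr0.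
    have := mdeg_box_opp kc; rewrite cD; case: k Dk {h gE kc cD co g} => // k Dk.
    by rewrite mulnS /=; lia.
  rewrite /g raddf_sum big1 ?eqxx //= => l _; rewrite mcoeffZ mcoeffX.
  case: eqP => [e'|_]; last by rewrite mulr0.
  by rewrite /co e' (negPf kc) mul0r.
rewrite /g raddf_sum; apply: hom_sum => l _ /=; rewrite mcoeffZ mcoeffX.
case: eqP => _; last by rewrite mulr0; apply: hom0.
rewrite mulr1 /co; case: ifP => _; last exact: hom0.
by apply: (@homM _ _ 0 e); [apply: homC | apply: h2].
Qed.
End Dual.

(** * The Cech complex of P/fP in degrees n - 1 and n *)

Local Notation frac := Defs.frac.

Section Fractions.
Variables (R : comNzRingType) (A : lmodType R) (s : R).
Implicit Types (u v : A) (k : nat).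

Lemma frac_eq0 u k : frac s u k = 0 <-> exists t, s ^+ t *: u = 0.
Proof.
split=> [/fracP [t]|[t e]].
  by rewrite !scaler0 expr0 scale1r => e; exists t.
by apply/fracP; exists t; rewrite !scaler0 expr0 scale1r.
Qed.

Lemma frac_shift u k t : frac s u k = frac s (s ^+ t *: u) (k + t).
Proof. by apply: frac_eq; rewrite scalerA -exprD. Qed.

Lemma fracDk u v k : frac s u k + frac s v k = frac s (u + v) k.
Proof.
rewrite fracD; apply: frac_eq.
by rewrite -scalerDr scalerA -exprD.
Qed.

Lemma frac0 k : frac s (0 : A) k = 0.
Proof. by apply/frac_eq0; exists 0%N; rewrite scaler0. Qed.

Lemma frac_sum (I : Type) (r : seq I) (Q : pred I) (f : I -> A) k :
  \sum_(i <- r | Q i) frac s (f i) k = frac s (\sum_(i <- r | Q i) f i) k.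
Proof.
elim: r => [|i r IH]; first by rewrite !big_nil frac0.
by rewrite !big_cons; case: ifP => // _; rewrite IH fracDk.
Qed.

End Fractions.

Lemma locm_map0 (R : comNzRingType) (A : lmodType R) (s t s' : R) :
  s' = s * t -> locm_map t s' (0 : locm A s) = 0.
Proof.
by move=> e; rewrite -[X in locm_map _ _ X](frac0 A s 0) (locm_mapE e) scaler0 frac0.
Qed.

Section CechQuotient.
Variables (R : comNzRingType) (n : nat) (f : {mpoly R[n]}).
Local Notation P := {mpoly R[n]}.
Local Notation A := (quot_mod (cyclic_sub (f : P^o))).
Local Notation y := (fun k : 'I_n => 'X_k : P).
Local Notation pi := (@quot_pi P P^o (cyclic_sub (f : P^o))).

Lemma pi_eq0 (p : P) : pi p = 0 <-> exists a, p = a * f.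
Proof.
have e0 : pi 0 = 0 by exact: (raddf0 pi).
rewrite -{1}e0; split.
  by move=> /quot_piE; rewrite subr0 => /asboolP.
by move=> h; apply/quot_piE; rewrite subr0; apply/asboolP.
Qed.

Lemma piZ (a p : P) : a *: pi p = pi (a * p).
Proof. exact: (quot_scale_pi _ a (p : P^o)). Qed.

(** The sign that makes the differential of top_cochain unsigned; the set I will
    miss a single i. *)
Definition missing_sum (p : 'I_n -> P) (I : {set 'I_n}) : P :=
  \sum_(i | i \notin I) (-1) ^+ i * p i.

(** The (n-1)-cochain with fractions p_i / y_I^k, up to sign, where I misses i. *)
Definition top_cochain k (p : 'I_n -> P) : cech y A := fun I =>
  if #|I| == n.-1 then frac _ (pi (missing_sum p I)) k else 0.

Lemma missing_sumC1 p i : missing_sum p [set~ i]%SET = (-1) ^+ i * p i.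
Proof. by rewrite /missing_sum (big_pred1 i) // => j; rewrite !inE negbK. Qed.

Lemma top_cochain_linear k (a : P) p q :
  top_cochain k (fun i => a * p i + q i) = a *: top_cochain k p + top_cochain k q.
Proof.
apply: functional_extensionality_dep => I.
rewrite -[RHS]/(a *: top_cochain k p I + top_cochain k q I) /top_cochain.
case: ifP => _; last by rewrite scaler0 addr0.
rewrite fracZ fracDk piZ -(raddfD pi); congr (frac _ (pi _) _).
rewrite /missing_sum mulr_sumr -big_split; apply: eq_bigr => i _ /=.
by rewrite mulrDr mulrCA.
Qed.

Definition yco (i : 'I_n) : P := \prod_(j | j != i) 'X_j.

Lemma prod_setC1 i : \prod_(k in [set~ i]%SET) 'X_k = yco i.
Proof. by apply: eq_bigl => k; rewrite !inE. Qed.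

Lemma card_predn_setC1 (I : {set 'I_n}) : #|I| == n.-1 -> (0 < n)%N -> exists i, I = [set~ i]%SET.
Proof.
move=> cI n0; have : #|~: I| == 1%N.
  have := cardsC I; rewrite card_ord (eqP cI) => e; apply/eqP.
  by move: e n0; move: #|~: I|%SET => c; clear; lia.
by move=> /cards1P [i e]; exists i; rewrite -e finset.setCK.
Qed.

Lemma top_cochain_shift k t p : (0 < n)%N ->
  top_cochain (k + t) (fun i => yco i ^+ t * p i) = top_cochain k p.
Proof.
move=> n0; apply: functional_extensionality_dep => I; rewrite /top_cochain.
case: ifP => // /card_predn_setC1 [] // i ->.
rewrite !missing_sumC1 [RHS](frac_shift _ _ _ t) prod_setC1 piZ.
by rewrite mulrCA.
Qed.

Lemma cechE (c : cech y A) J : cech_d c J =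
  \sum_(i in J) (-1) ^+ #|[set k in J | (k < i)%N]| *:
    locm_map (y i) (\prod_(k in J) y k) (c (J :\ i)%SET).
Proof. by []. Qed.

Lemma top_cochain_d0 k p J : J != [set: 'I_n]%SET -> cech_d (top_cochain k p) J = 0.
Proof.
move=> JT; rewrite cechE; apply: big1 => i iJ; rewrite /top_cochain.
have nJ : #|J| != n.
  apply: contraNneq JT => e; rewrite eqEcard finset.subsetT cardsT card_ord e.
  by rewrite leqnn.
rewrite (cardsD1 i) iJ in nJ.
have -> : (#|J :\ i| == n.-1)%SET = false.
  by apply/negP => /eqP e; move: nJ; rewrite e; have := ltn_ord i; lia.
by rewrite locm_map0 ?scaler0 // (big_setD1 i) //= mulrC.
Qed.

Lemma card_below (i : 'I_n) : #|[set k in [set: 'I_n] | (k < i)%N]%SET| = i.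
Proof.
rewrite -sum1_card (eq_bigl (fun k : 'I_n => (k < i)%N)); last by move=> k; rewrite !inE.
by rewrite -(big_ord_widen n (fun=> 1%N) (ltnW (ltn_ord i))) sum1_card card_ord.
Qed.

Lemma top_cochain_dT k p :
  cech_d (top_cochain k p) [set: 'I_n]%SET = frac _ (pi (\sum_i 'X_i ^+ k * p i)) k.
Proof.
transitivity (\sum_i frac (\prod_(k in [set: 'I_n]%SET) 'X_k) (pi ('X_i ^+ k * p i)) k); last first.
  by rewrite frac_sum -(raddf_sum pi).
rewrite cechE; apply: eq_big => [i|i _]; first by rewrite finset.in_setT.
rewrite card_below /top_cochain.
have -> : ([set: 'I_n] :\ i)%SET = [set~ i]%SET by rewrite finset.setTD.
have -> : #|[set~ i]%SET| == n.-1 by rewrite cardsC1 card_ord.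
rewrite (locm_mapE (t := 'X_i)); last first.
  by rewrite (bigD1 i) ?inE //= mulrC; congr (_ * _); apply: eq_bigl => j; rewrite !inE.
rewrite fracZ missing_sumC1 (piZ ('X_i ^+ k)) (piZ ((-1) ^+ i)); congr (frac _ (pi _) _).
by rewrite mulrCA [(-1) ^+ i * (_ * _)]mulrA -exprD -signr_odd oddD addbb mul1r.
Qed.

End CechQuotient.

Lemma prodX_exp (R : comNzRingType) n t :
  (\prod_(i < n) ('X_i : {mpoly R[n]})) ^+ t = 'X_[[multinom t | _ < n]].
Proof.
rewrite [RHS]mpolyXE_id -prodrXl; apply: eq_bigr => i _.
by rewrite mnmE.
Qed.

Lemma prod_yco (R : comNzRingType) n (l : 'I_n) :
  \prod_i ('X_i : {mpoly R[n]}) = 'X_l * yco R l.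
Proof. by rewrite (bigD1 l). Qed.

Lemma shifted_sum (R : comNzRingType) n k t (p : 'I_n -> {mpoly R[n]}) :
  \sum_i 'X_i ^+ (k + t) * (yco R i ^+ t * p i) =
  'X_[[multinom t | _ < n]] * \sum_i 'X_i ^+ k * p i.
Proof.
rewrite -prodX_exp mulr_sumr; apply: eq_bigr => i _.
by rewrite (prod_yco R i) exprMn exprD; ring.
Qed.

Lemma sum_alternating (V : zmodType) n (g : 'I_n -> 'I_n -> V) :
  (forall l i, l != i -> g l i = - g i l) -> \sum_l \sum_(i | i != l) g l i = 0.
Proof.
move=> ga.
have -> : \sum_l \sum_(i | i != l) g l i =
    \sum_(l < n) \sum_(i < n | (i < l)%N) g l i +
    \sum_(l < n) \sum_(i < n | (l < i)%N) g l i.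
  rewrite -big_split; apply: eq_bigr => l _ /=.
  rewrite (bigID (fun i : 'I_n => (i < l)%N)) /=; congr (_ + _); apply: eq_bigl => i.
    by rewrite andb_idl // => il; apply: contraTneq il => ->; rewrite ltnn.
  by rewrite -leqNgt ltn_neqAle; congr (_ && _); rewrite eq_sym.
rewrite [X in _ + X](exchange_big_dep xpredT) //= -big_split big1 //= => l _.
rewrite -big_split big1 //= => i il; rewrite ga ?addNr //.
by apply: contraTneq il => ->; rewrite ltnn.
Qed.

Section CechBoundaries.
Variables (R : comNzRingType) (n : nat) (f : {mpoly R[n]}).
Hypothesis n_gt1 : (1 < n)%N.
Local Notation P := {mpoly R[n]}.
Local Notation A := (quot_mod (cyclic_sub (f : P^o))).
Local Notation y := (fun k : 'I_n => 'X_k : P).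
Local Notation pi := (@quot_pi P P^o (cyclic_sub (f : P^o))).

Lemma card_below_setC1 (l i : 'I_n) : l != i ->
  #|[set k in [set~ l] | (k < i)%N]%SET| = (i - (l < i))%N.
Proof.
move=> li; pose S := [set k in [set: 'I_n] | (k < i)%N]%SET.
have -> : [set k in [set~ l] | (k < i)%N]%SET = (S :\ l)%SET.
  by apply/setP => k; rewrite !inE.
have := cardsD1 l S; rewrite card_below.
have -> : (l \in S) = (l < i)%N by rewrite !inE.
by move: #|(S :\ l)%SET| => c; lia.
Qed.

(** Apart from a factor (-1)^l, the exponent of the sign with which the component at
    the complement of {l, i} enters the differential at the complement of l. Without
    that factor the sign is antisymmetric (face_signC). *)
Definition face_sign (l i : 'I_n) : nat := (l + i + (l < i))%N.

Lemma face_signE (l i : 'I_n) : l != i ->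
  (-1) ^+ #|[set k in [set~ l] | (k < i)%N]%SET| = (-1) ^+ l * (-1) ^+ face_sign l i :> P.
Proof.
move=> li; rewrite card_below_setC1 // /face_sign -exprD -signr_odd -[RHS]signr_odd.
congr (_ ^+ (nat_of_bool _)); rewrite !oddD addbA addbA addbb addFb.
by case: ltnP => lti; rewrite ?oddB ?addbF ?subn0 //=; apply: leq_ltn_trans lti.
Qed.

Let signrMK_face m (p : P) : (-1) ^+ m * ((-1) ^+ m * p) = p.
Proof. by rewrite mulrA -exprD -signr_odd oddD addbb mul1r. Qed.

Lemma face_signC (l i : 'I_n) : l != i ->
  (-1) ^+ face_sign l i = - (-1) ^+ face_sign i l :> P.
Proof.
move=> li; rewrite /face_sign ![(-1) ^+ (_ + _ + _)]exprD [(i + l)%N]addnC.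
have := li; rewrite -(inj_eq val_inj) neq_ltn => /orP [h|h].
  by rewrite h ltnNge (ltnW h) /= expr0 expr1 mulr1 mulrN1.
by rewrite h ltnNge (ltnW h) /= expr0 expr1 mulr1 mulrN1 opprK.
Qed.

Lemma cech_d_setC1 (b : cech y A) l (u : 'I_n -> P) k :
    (forall i, i != l -> b ([set~ l] :\ i)%SET = frac _ (pi (u i)) k) ->
  cech_d b [set~ l]%SET =
  frac _ (pi ((-1) ^+ l * \sum_(i | i != l) (-1) ^+ face_sign l i * ('X_i ^+ k * u i))) k.
Proof.
move=> bu; transitivity (\sum_(i | i != l) frac (\prod_(k in [set~ l]%SET) 'X_k)
   (pi ((-1) ^+ l * ((-1) ^+ face_sign l i * ('X_i ^+ k * u i)))) k); last first.
  by rewrite frac_sum -(raddf_sum pi) mulr_sumr.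
rewrite cechE; apply: eq_big => [i|i il]; first by rewrite !inE.
have {}il : i != l by move: il; rewrite !inE.
rewrite bu // (locm_mapE (t := 'X_i)); last first.
  by rewrite (big_setD1 i) ?inE //= mulrC.
rewrite fracZ (piZ f ('X_i ^+ k)) face_signE 1?eq_sym //.
by rewrite (piZ f ((-1) ^+ l * (-1) ^+ face_sign l i)) -mulrA.
Qed.

Lemma top_cochain_setC1 k p i :
  top_cochain f k p [set~ i]%SET = frac _ (pi ((-1) ^+ i * p i)) k.
Proof. by rewrite /top_cochain cardsC1 card_ord eqxx missing_sumC1. Qed.

Lemma pi_eq (p q : P) : pi p = pi q <-> exists a, p = q + a * f.
Proof.
split=> [/quot_piE /asboolP [a e]|[a ->]].
  by exists a; rewrite -[a * f]/(a *: (f : P^o)) -e addrC subrK.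
by apply/quot_piE/asboolP; exists a; rewrite addrAC subrr add0r.
Qed.

(** The coefficients a_li of trivial relations are, up to face_sign, the components
    of a bounding cochain at the complements of {l, i}; the twisted coefficients g are
    symmetric, so it does not matter in which order the pair l, i is picked. *)
Lemma top_cochain_boundary k (p q : 'I_n -> P) (a : 'I_n -> 'I_n -> P) :
    (forall i j, a i j = - a j i) -> (forall i, a i i = 0) ->
    (forall i, p i = \sum_j a i j * 'X_j ^+ k + q i * f) ->
  exists b, top_cochain f k p = cech_d b.
Proof.
move=> aC a0 pE.
pose g l i := (-1) ^+ face_sign l i * a l i.
have gC l i : l != i -> g l i = g i l.
  by move=> li; rewrite /g aC face_signC // mulrNN.
pose pr (I : {set 'I_n}) :=
  [pick w : 'I_n * 'I_n | (w.1 != w.2) && (I == ~: [set w.1; w.2])%SET].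
have prP I u v : u != v -> I = (~: [set u; v])%SET -> exists2 w, pr I = Some w & g w.1 w.2 = g u v.
  move=> uv ->; rewrite /pr; case: pickP => [[w1 w2] /= /andP [w12 /eqP e]|/(_ (u, v))].
    exists (w1, w2) => //=.
    have e' : ([set u; v] = [set w1; w2])%SET by apply: finset.setC_inj.
    have : u \in ([set w1; w2])%SET by rewrite -e' !inE eqxx.
    have : v \in ([set w1; w2])%SET by rewrite -e' !inE eqxx orbT.
    rewrite !inE => vw uw; case/orP: uw uv => /eqP ->; case/orP: vw => /eqP -> //.
    - by rewrite eqxx.
    - by move=> _; apply: gC.
    - by rewrite eqxx.
  by rewrite /= uv eqxx.
pose b : cech y A := fun I =>
  if pr I is Some w then frac _ (pi (g w.1 w.2)) k else 0.
exists b; apply: functional_extensionality_dep => J.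
case: (boolP (#|J| == n.-1)) => cJ; last first.
  rewrite /top_cochain (negPf cJ) cechE; apply: esym; apply: big1 => i iJ.
  have -> : b (J :\ i)%SET = 0.
    rewrite /b /pr; case: pickP => // -[u v] /= /andP [uv /eqP e].
    case/eqP: cJ; rewrite (cardsD1 i) iJ e.
    have := cardsC [set u; v]%SET; rewrite card_ord cards2 uv /=.
    by move: #|_| => c; lia.
  by rewrite locm_map0 ?scaler0 // (big_setD1 i) //= mulrC.
have [|l ->] := card_predn_setC1 cJ; first exact: ltnW.
have hb i : i != l -> b ([set~ l] :\ i)%SET = frac _ (pi (g l i)) k.
  move=> il; rewrite /b; have [||w -> ->] // := prP ([set~ l] :\ i)%SET l i.
    by rewrite eq_sym.
  by apply/setP => j; rewrite !inE negb_or andbC.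
rewrite top_cochain_setC1 (cech_d_setC1 hb); congr (frac _ _ _).
apply/pi_eq; exists ((-1) ^+ l * q l); rewrite pE mulrDr mulrA; congr (_ * _ + _).
rewrite (bigD1 l) //= a0 mul0r add0r; apply: eq_bigr => i il.
by rewrite /g mulrCA signrMK_face mulrC.
Qed.

Lemma cochain_lift (c : cech y A) :
  exists k (u : {set 'I_n} -> P), forall I, c I = frac _ (pi (u I)) k.
Proof.
pose k := \max_(I : {set 'I_n}) frac_exp (c I).
have /choice [u hu] : forall I, exists u, c I = frac _ (pi u) k; last by exists k, u.
move=> I.
have kI : (frac_exp (c I) <= k)%N by apply: (leq_bigmax I).
exists ((\prod_(k in I) 'X_k) ^+ (k - frac_exp (c I)) * quot_repr (frac_num (c I))).
rewrite -(piZ f) (quot_reprK (frac_num (c I))).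
by rewrite -[LHS]fracK (frac_shift _ _ _ (k - frac_exp (c I))) subnKC.
Qed.

(** Clearing denominators, each p_l is up to multiples of f a signed sum of terms
    symmetric in l and i; in the sum over l these cancel in pairs, and what remains
    are the multiples of f. *)
Lemma boundary_power_ideal k (p : 'I_n -> P) b : top_cochain f k p = cech_d b ->
  exists t (q : 'I_n -> P), (\prod_i 'X_i) ^+ t * (\sum_i 'X_i ^+ k * p i) =
    (\sum_i 'X_i ^+ (k + t) * q i) * f.
Proof.
move=> pb; have [k' [u bu]] := cochain_lift b.
pose s l := \sum_(i | i != l) (-1) ^+ face_sign l i * ('X_i ^+ k' * u ([set~ l] :\ i)%SET).
have : forall l : 'I_n, exists t, forall t', (t <= t')%N ->
    exists q, yco R l ^+ (t' + k') * p l = yco R l ^+ (t' + k) * s l + q * f.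
  move=> l; have := congr1 (fun c : cech y A => c [set~ l]%SET) pb.
  rewrite /= top_cochain_setC1 (@cech_d_setC1 b l (fun i => u ([set~ l] :\ i)%SET) k');
    last by move=> i _.
  move=> /fracP [t]; rewrite prod_setC1 (piZ f (yco R l ^+ k')) (piZ f (yco R l ^+ k)).
  rewrite !(piZ f (yco R l ^+ t)) => /pi_eq [q qE].
  exists t => t' tt'; exists ((-1) ^+ l * q * yco R l ^+ (t' - t)).
  have s2 : (-1) ^+ l * (-1) ^+ l = 1 :> P by rewrite -exprD -signr_odd oddD addbb.
  have e1 w : yco R l ^+ (t' + w) = yco R l ^+ (t' - t) * (yco R l ^+ t * yco R l ^+ w).
    by rewrite -!exprD; congr (_ ^+ _); move: tt'; lia.
  have s2' w : w = ((-1) ^+ l * (-1) ^+ l) * w :> P by rewrite s2 mul1r.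
  rewrite !e1 [p l]s2' [s l]s2' /s.
  set sg := (-1) ^+ l in qE *.
  transitivity (sg * yco R l ^+ (t' - t) * (yco R l ^+ t * (yco R l ^+ k' * (sg * p l)))).
    by ring.
  by rewrite qE; ring.
move=> /choice [tf htf]; pose t := \max_l tf l.
have /choice [q hq] : forall l : 'I_n, exists q,
    yco R l ^+ (t + k') * p l = yco R l ^+ (t + k) * s l + q * f.
  by move=> l; apply: htf; apply: (leq_bigmax l).
exists (t + k')%N, q.
have yE (l : 'I_n) : \prod_i 'X_i = 'X_l * yco R l by rewrite (bigD1 l).
rewrite mulr_sumr mulr_suml.
have -> : \sum_i (\prod_i 'X_i) ^+ (t + k') * ('X_i ^+ k * p i) =
   \sum_l ('X_l ^+ (k + (t + k')) * (yco R l ^+ (t + k) * s l) + 'X_l ^+ (k + (t + k')) * q l * f).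
  apply: eq_bigr => l _; rewrite (yE l) exprMn -[X in _ + X]mulrA -mulrDr -hq [_ ^+ (k + _)]exprD.
  by ring.
rewrite big_split /= -[RHS]add0r; congr (_ + _).
transitivity ((\prod_i 'X_i) ^+ (t + k) * \sum_l \sum_(i | i != l)
    (-1) ^+ face_sign l i * ('X_l ^+ k' * 'X_i ^+ k' * u ([set~ l] :\ i)%SET)).
  rewrite mulr_sumr; apply: eq_bigr => l _; rewrite (yE l) exprMn /s !mulr_sumr.
  apply: eq_bigr => i _; rewrite !exprD; ring.
rewrite (@sum_alternating _ n (fun l i => (-1) ^+ face_sign l i *
  ('X_l ^+ k' * 'X_i ^+ k' * u ([set~ l] :\ i)%SET))) ?mulr0 // => l i li.
rewrite (face_signC li) mulNr.
have -> : ([set~ l] :\ i)%SET = ([set~ i] :\ l)%SET by apply/setP => j; rewrite !inE andbC.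
by rewrite ['X_l ^+ k' * _]mulrC.
Qed.
End CechBoundaries.

(** * The local cohomology module as the kernel of a power of the polarization *)

Section Cohomology.
Variables (K : fieldType) (n : nat).
Hypothesis charK : [pchar K] =i pred0.
Hypothesis n_gt1 : (1 < n)%N.
Local Notation P0 := {mpoly K[n]}.
Local Notation P := {mpoly {mpoly K[n]}[n]}.
Variables (lam : 'rV[K]_n) (r d : nat).
Hypothesis lam0 : forall i, lam 0 i != 0.
Local Notation fr := (f_lambda lam ^+ r).
Local Notation y := (fun k : 'I_n => 'X_k : P).
Local Notation A := (quot_mod (cyclic_sub (fr : P^o))).
Local Notation pi := (@quot_pi P P^o (cyclic_sub (fr : P^o))).
Local Notation H := (local_cohomology (n - 1) (cyclic_quotient fr)).

Definition cech_class (c : cech y A) : H := @quot_pi _ _ (im_sub (@cech_d P n y A)) c.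

(** The connecting homomorphism H^(n-1)(P/f^r) -> H^n(P): a cocycle is lifted to the
    p_i, whose coboundary is f^r times g / (y_1 ... y_n)^k, and this fraction is
    read as a polynomial in z. *)
Definition represents (x : H) (G : P) : Prop := exists k p g,
  [/\ x = cech_class (top_cochain fr k p), \sum_i 'X_i ^+ k * p i = g * fr & dual k g = G].

Lemma bihom_f_lambda : bihom 1 1 (f_lambda lam).
Proof.
apply: bihom_sum => i _; rewrite mul_mpolyC.
apply: (@bihomZ _ _ 0 1 1); last exact: bihomXU.
by rewrite -mul_mpolyC; apply: (@homM _ _ 0 1); [apply: homC | apply: homX].
Qed.

Lemma bihom_fr : bihom r r fr.
Proof. by have := bihomXn (r := r) bihom_f_lambda; rewrite mul1n. Qed.

Lemma fr_neq0 : fr != 0.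
Proof.
apply: expf_neq0_mpoly; apply/eqP; pose i := Ordinal n_gt1.
move=> /(congr1 (fun p : P => p@_U_(i)@_U_(i))).
rewrite !mcoeff0 /f_lambda raddf_sum (bigD1 i) //= mcoeffCM mcoeffX eqxx mulr1.
rewrite big1 ?addr0 => [|j ji].
  by rewrite mcoeffZ mcoeffX eqxx mulr1 => /eqP; rewrite (negPf (lam0 i)).
rewrite mcoeffCM mcoeffX; case: eqP => [/(congr1 (fun m : 'X_{1..n} => m i))|_];
  last by rewrite mulr0.
by rewrite !mnm1E eqxx (negPf ji).
Qed.

Lemma cech_class_linear (a : P) c c' :
  cech_class (a *: c + c') = a *: cech_class c + cech_class c'.
Proof.
rewrite /cech_class quot_piD; congr (_ + _).
exact/esym/quot_scale_pi.
Qed.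

Lemma cech_class_eq0 c : cech_class c = 0 <-> exists b, c = cech_d b.
Proof.
have e0 : cech_class 0 = 0 by by apply: (addrI (cech_class 0)); rewrite addr0 -quot_piD addr0.
rewrite -e0; split.
  by move=> /quot_piE; rewrite subr0 => /asboolP.
by move=> h; apply/quot_piE; rewrite subr0; apply/asboolP.
Qed.

Lemma represents_shift k t x (p : 'I_n -> P) g :
    x = cech_class (top_cochain fr k p) -> \sum_i 'X_i ^+ k * p i = g * fr ->
  exists p', [/\ x = cech_class (top_cochain fr (k + t) p'),
    \sum_i 'X_i ^+ (k + t) * p' i = ('X_[[multinom t | _ < n]] * g) * fr
    & dual (k + t) ('X_[[multinom t | _ < n]] * g) = dual k g].
Proof.
move=> xE pg; exists (fun i => yco P0 i ^+ t * p i); split.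
- by rewrite top_cochain_shift // ltnW.
- by rewrite shifted_sum pg mulrA.
- exact: dual_shift.
Qed.

Lemma represents_linear (a : P0) x x' G G' : represents x G -> represents x' G' ->
  represents (a%:MP *: x + x') (a *: G + G').
Proof.
move=> [k [p [g [xE pg <-]]]] [k' [p' [g' [xE' pg' <-]]]].
have [q [xq qg qd]] := represents_shift k' xE pg.
have [q' [xq' qg' qd']] := represents_shift k xE' pg'.
rewrite addnC in xq' qg' qd'.
exists (k + k')%N, (fun i => a%:MP * q i + q' i),
  (a%:MP * ('X_[[multinom k' | _ < n]] * g) + 'X_[[multinom k | _ < n]] * g'); split.
- rewrite top_cochain_linear xq xq'.
  exact/esym/cech_class_linear.
- rewrite mulrDl -[a%:MP * _ * fr]mulrA -qg -qg' mulr_sumr -big_split; apply: eq_bigr => i _ /=.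
  by rewrite mulrDr mulrCA.
by rewrite mul_mpolyC linearP /= qd qd'.
Qed.

(** Injectivity of the connecting homomorphism, that is H^(n-1)(P) = 0: if g lies in
    the ideal of the y_i^k, the lift can be changed modulo f^r into a cocycle of P,
    whose components then satisfy trivial relations only. *)
Lemma represents0 x : represents x 0 -> x = 0.
Proof.
move=> [k [p [g [-> pg /(dual_eq0_split charK) [q [gq _]]]]]].
apply/cech_class_eq0.
have [a [aC a0 pa]] : exists a : 'I_n -> 'I_n -> P,
    [/\ forall i j, a i j = - a j i, forall i, a i i = 0
      & forall i, p i - q i * fr = \sum_j a i j * 'X_j ^+ k].
  apply: (koszul_relations (p := fun i => p i - q i * fr)).
  rewrite (eq_bigr (fun i => 'X_i ^+ k * p i - 'X_i ^+ k * q i * fr)); last first.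
    by move=> i _; rewrite mulrBr mulrA.
  by rewrite sumrB -mulr_suml -gq pg subrr.
apply: (top_cochain_boundary (q := q) _ aC a0) => // i.
by rewrite -pa subrK.
Qed.

(** The connecting homomorphism is well defined; the nonzerodivisor f^r cancels. *)
Lemma represents_zero G : represents 0 G -> G = 0.
Proof.
move=> [k [p [g [/esym /cech_class_eq0 [b bE] pg <-]]]].
have [t [q qE]] := boundary_power_ideal n_gt1 bE.
rewrite -(dual_shift k t) -prodX_exp.
move: qE; rewrite pg mulrA => /(mulIf_mpoly fr_neq0) ->.
exact: dual_power_ideal.
Qed.

Local Notation j := (- n%:Z - d%:Z).

(** For G in the kernel, f^r g has trivial class in H^n(P), hence is a combination of
    the y_i^k. The exponent k = d + r + 1 exceeds all exponents of G. *)
Lemma kernel_represented e G : polar_kernel (lam 0) r d e G ->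
  exists x, represents x G /\ @bg_comp _ H (e + r)%:Z j x.
Proof.
move=> [hG DG].
have [g gG hg] := dual_preimage charK hG (ltnSn _).
have frg : dual (d + r).+1 (fr * g) = 0 by rewrite dual_f_lambdaX // gG.
have [q [qE qc]] := dual_eq0_split charK frg.
have hfg := bihomM bihom_fr hg.
have qdeg i m k : (q i)@_m@_k != 0 ->
    (mdeg m + (d + r).+1 = r + (n * (d + r) - (d + r)))%N /\ mdeg k = (e + r)%N.
  case: (qc i m) => ->; first by rewrite mcoeff0 eqxx.
  move=> /hfg [md kd]; split; last by rewrite kd addnC.
  by rewrite -md mdegD mdegMn mdeg1 mul1n.
exists (cech_class (top_cochain fr (d + r).+1 q)); split.
  by exists (d + r).+1, q, g; split; rewrite // -qE mulrC.
exists (top_cochain fr (d + r).+1 q); split=> //.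
- move=> I cI; rewrite /top_cochain; case: eqP => // e1.
  by case: cI; rewrite e1 subn1.
- apply: functional_extensionality_dep => J.
  case: (eqVneq J [set: 'I_n]%SET) => [->|JT]; last exact: top_cochain_d0.
  rewrite top_cochain_dT -qE; have /pi_eq0 -> : exists a, fr * g = a * fr.
    by exists g; rewrite mulrC.
  exact: frac0.
move=> I; rewrite /locm_comp /=; case: (boolP (#|I| == n.-1)) => cI; last first.
  exists 0%N, (pi 0); split.
    by exists 0 => // m; rewrite msupp0.
  rewrite /top_cochain (negPf cI); have -> : pi 0 = 0 by apply/pi_eq0; exists 0; rewrite mul0r.
  by rewrite frac0.
exists (d + r).+1, (pi (missing_sum q I)); split; last by rewrite /top_cochain cI.
exists (missing_sum q I) => // m; rewrite mcoeff_msupp => hm.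
have hdeg m' k : (missing_sum q I)@_m'@_k != 0 ->
    (mdeg m' + (d + r).+1 = r + (n * (d + r) - (d + r)))%N /\ mdeg k = (e + r)%N.
  rewrite /missing_sum => h.
  have [i /qdeg //] : exists i, (q i)@_m'@_k != 0.
  apply: contrapT => /forallNP nh; case/eqP: h; rewrite !raddf_sum big1 // => i _ /=.
  rewrite -signr_odd; have /negP := nh i; rewrite negbK => /eqP e0.
  by case: odd; rewrite ?mul1r ?mulN1r ?mcoeffN e0 ?oppr0.
split; last first.
  by move=> k; rewrite mcoeff_msupp => /hdeg [_ ->].
have [k /hdeg [md _]] : exists k, (missing_sum q I)@_m@_k != 0.
  apply: contrapT => /forallNP nh; case/eqP: hm; apply/mpolyP => k; rewrite mcoeff0.
  by have /negP := nh k; rewrite negbK => /eqP.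
rewrite (eqP cI); move: md n_gt1; move: (mdeg m) => D; clear.
by case: n => // n'; rewrite mulSn addKn mulSn /=; lia.
Qed.

(** J may be negative, in which case p is zero. *)
Lemma hom_nat_int (R : comNzRingType) N D (a p : {mpoly R[n]}) (J : int) :
    hom N a -> (forall m, m \in msupp p -> (mdeg m)%:Z = J) -> D%:Z = N%:Z + J ->
  hom D (a * p).
Proof.
move=> ha hp DJ; case: (lerP 0 J) => J0.
  have -> : D = (N + `|J|)%N by lia.
  by apply: homM => // m; rewrite -mcoeff_msupp => /hp; lia.
suff -> : p = 0 by rewrite mulr0; apply: hom0.
apply/mpolyP => m; rewrite mcoeff0; apply/eqP/negPn/negP.
by rewrite -mcoeff_msupp => /hp; lia.
Qed.

(** The lift p of a homogeneous cocycle is homogeneous in y; so is f^r g after raising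
    the exponent, and g may be replaced by its part of the right degree. That g
    represents a polynomial killed by D^r expresses that f^r g is a coboundary. *)
Lemma component_represented (i : int) (x : H) : @bg_comp _ H i j x ->
  exists G, [/\ represents x G, hom (d + r) G & iter r (polar (lam 0)) G = 0].
Proof.
move=> [c [cdeg dc chom xE]].
have /choice [kp hkp] : forall l : 'I_n, exists kp : nat * P,
    c [set~ l]%SET = frac _ (pi kp.2) kp.1 /\
    forall m, m \in msupp kp.2 -> (mdeg m)%:Z = j + (kp.1 * n.-1)%:Z.
  move=> l; have [k [u [[p hp <-] e]]] := chom [set~ l]%SET.
  exists (k, p); split=> // m /hp [-> _].
  by rewrite cardsC1 card_ord.
(* A common exponent; the summand n + d + r makes the y-degrees below nonnegative. *)
pose k0 := (\max_l (kp l).1 + (n + d + r))%N.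
pose p0 (l : 'I_n) := (-1) ^+ l * (yco P0 l ^+ (k0 - (kp l).1) * (kp l).2).
have kle l : ((kp l).1 <= k0)%N.
  by apply: leq_trans (leq_addr _ _); apply: (leq_bigmax l).
have cE : c = top_cochain fr k0 p0.
  apply: functional_extensionality_dep => I; case: (boolP (#|I| == n.-1)) => cI; last first.
    rewrite /top_cochain (negPf cI) cdeg //; apply/eqP; by rewrite subn1.
  have [|l ->] := card_predn_setC1 cI; first exact: ltnW.
  rewrite top_cochain_setC1 // (hkp l).1 (frac_shift _ _ _ (k0 - (kp l).1)) subnKC //.
  rewrite prod_setC1 piZ /p0.
  by rewrite mulrA -exprD -signr_odd oddD addbb mul1r.
have n1 : n = n.-1.+1 by rewrite prednK // ltnW.
have yh (l : 'I_n) t : hom (t * n.-1) (yco P0 l ^+ t).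
  apply: homXn; have -> : n.-1 = #|[pred i | i != l]| by rewrite cardC1 card_ord.
  by apply: hom_prod => i0; apply: homX.
have k0ge : (n + d + r <= k0 * n.-1)%N.
  by apply: (@leq_trans k0); rewrite ?leq_addl // leq_pmulr //; move: n_gt1; lia.
have p0h l : hom (k0 * n.-1 - n - d) (p0 l).
  rewrite /p0 -signr_odd mulrA; apply: (hom_nat_int (N := (k0 - (kp l).1) * n.-1) _ (hkp l).2).
    by case: odd; rewrite ?expr0 ?expr1 ?mul1r ?mulN1r; [apply: homN|]; apply: yh.
  have := leq_mul2r n.-1 (kp l).1 k0; rewrite kle orbT mulnBl.
  by move: k0ge; move: (k0 * n.-1)%N ((kp l).1 * n.-1)%N => a b; clear; lia.
have [t [a at_]] : exists t a, (\prod_i 'X_i) ^+ t * (\sum_i 'X_i ^+ k0 * p0 i) = a * fr.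
  pose Y : P := \prod_(l in [set: 'I_n]%SET) 'X_l.
  have fe : frac Y (pi (\sum_i 'X_i ^+ k0 * p0 i)) k0 = 0.
    by rewrite /Y -top_cochain_dT -cE dc.
  have [t te] := proj1 (frac_eq0 _ _ _) fe.
  have /pi_eq0 [a ae] := etrans (esym (piZ fr (Y ^+ t) (\sum_i 'X_i ^+ k0 * p0 i))) te.
  have YE : Y = \prod_i 'X_i by apply: eq_bigl => l; rewrite finset.in_setT.
  by exists t, a; rewrite -YE.
pose k1 := (k0 + t)%N; pose p1 (l : 'I_n) := yco P0 l ^+ t * p0 l.
have s1 : \sum_i 'X_i ^+ k1 * p1 i = a * fr by rewrite shifted_sum -prodX_exp.
pose D := (n * k1 - n - d - r)%N.
have k1ge : (n + d + r <= n * k1)%N.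
  by rewrite /k1 n1 mulSn mulnDr; move: k0ge; rewrite [(k0 * _)%N]mulnC -n1; lia.
have s1h : hom (D + r) (\sum_i 'X_i ^+ k1 * p1 i).
  apply: hom_sum => l _; have -> : (D + r = k1 * 1 + (t * n.-1 + (k0 * n.-1 - n - d)))%N.
    rewrite /D /k1 n1 /= mulSn mulnDr muln1 -n1; move: k0ge; rewrite ![(_ * n.-1)%N]mulnC.
    by lia.
  by apply: homM; [apply: homXn; apply: homX | apply: homM].
pose g := pihomog mdeg D a.
have gE : \sum_i 'X_i ^+ k1 * p1 i = g * fr.
  have frh : hom r fr by have /bihomE [] := bihom_fr.
  by rewrite -(pihomog_hom s1h) s1; apply: pihomogM_hom.
exists (dual k1 g); split.
- have c1 : top_cochain fr k1 p1 = c.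
    by rewrite cE; apply: top_cochain_shift; apply: ltnW.
  exists k1, p1, g; split; [by rewrite c1 | exact: gE | exact: erefl].
- move=> m; rewrite mcoeff_dual /dual_coeff; case: ifP; last by rewrite eqxx.
  move=> km h; have := mdeg_box_opp km.
  have -> : mdeg (box_opp k1 m) = D.
    apply: (hom_pihomog (p := a)); apply: contraNneq h => e; by rewrite e mulr0.
  by move: k1ge; rewrite /D; lia.
by rewrite -dual_f_lambdaX // mulrC -gE dual_power_ideal.
Qed.

(** All generators of step p of the resolution have degree d + 1 + r + p: the
    generators of the kernel have x-degree d + 1, the lifts p_i of their
    representatives gain the x-degree r of f^r, and the differentials are linear. *)
Lemma regularity_component : (0 < r)%N -> reg_eq (y_comp H j) (d.+1 + r)%N%:Z.
Proof.
move=> r0; split.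
  have [v [hv Dv v0]] := iter_polar_kernel_neq0 lam0 d r0 n_gt1.
  have [x [xv hx]] := kernel_represented (conj hv Dv).
  exists (d.+1 + r)%N%:Z, x; split=> // x0.
  by case/eqP: v0; apply: represents_zero; rewrite -x0.
have [b0 [B [BK Bg gB]]] := polar_kernel_generators charK lam0 r d.
have Bspan := polar_kernel_span charK lam0 Bg.
have [b [e [D [D1 D0 DS]]]] := linear_resolution charK gB.
subst b0.
have {}D0 v : comb B v = 0 <-> exists w, v = w *m D 0%N.
  rewrite -D0; have -> // : (fun k => B (cast_ord erefl k)) = B.
  by apply/funext => k; rewrite cast_ord_id.
have /choice [u hu] : forall k, exists x, represents x (B k) /\ @bg_comp _ H (d.+1 + r)%:Z j x.
  by move=> k; apply: kernel_represented.
have urep (v : 'rV[P0]_(b 0%N)) :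
    represents (\sum_k v 0 k *: (u k : y_comp H j)) (comb B v).
  rewrite /comb; elim: (index_enum _) => [|k s IH]; last first.
    by rewrite !big_cons; apply: represents_linear; [exact: (hu k).1 | exact: IH].
  rewrite !big_nil; exists 0%N, (fun=> 0), 0; split.
  - apply/esym/cech_class_eq0; exists 0; rewrite raddf0.
    apply: functional_extensionality_dep => I; rewrite /top_cochain.
    by case: ifP => // _; apply/frac_eq0; exists 0%N; rewrite expr0 scale1r;
      apply/pi_eq0; exists 0; rewrite /missing_sum mul0r big1 // => i _; rewrite mulr0.
  - by rewrite mul0r big1 // => i _; rewrite mulr0.
  - exact: (raddf0 (dual 0)).
have b0gt : (0 < b 0%N)%N.
  have [v [hv Dv v0]] := iter_polar_kernel_neq0 lam0 d r0 n_gt1.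
  have [w wv] : exists w, comb B w = v by apply: (Bg 0%N); rewrite addn0.
  rewrite lt0n; apply: contraNneq v0 => bE; rewrite -wv /comb big1 // => i _.
  by have := ltn_ord i; rewrite {2}bE.
exists b, (fun p _ => (d.+1 + r + p)%N%:Z), u, D; split.
- split.
  + by move=> k; rewrite addn0; apply: (hu k).2.
  + by move=> p k l m; rewrite mcoeff_msupp => /D1 ->; lia.
  + by move=> p k l; apply/eqP/negPn/negP => /D1; rewrite mdeg0.
  + move=> i x hx; have [G [xG Gd DG]] := component_represented hx.
    have [v vG] := Bspan G Gd DG; exists v.
    apply/eqP; rewrite -subr_eq0; apply/eqP/represents0.
    have := represents_linear (-1) (urep v) xG.
    rewrite vG scaleN1r addNr; congr represents.
    by rewrite mpolyCN scaleN1r addrC.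
  + move=> v; rewrite -D0; split=> [v0|v0].
      by apply: represents_zero; have := urep v; rewrite v0.
    by apply: represents0; have := urep v; rewrite v0.
  + exact: DS.
- by exists 0%N, (Ordinal b0gt); lia.
- by move=> p k; lia.
Qed.

End Cohomology.

Theorem corollary4p4 (K : fieldType) (charK : [pchar K] =i pred0) (n : nat)
    (n_ge2 : (2 <= n)%N) (r : nat) (r_ge1 : (1 <= r)%N) :
  exists V : set 'rV[K]_n, [/\ zariski_open V, V !=set0 &
    forall lam : 'rV[K]_n, V lam -> forall j : int, j <= - n%:Z ->
      reg_eq
        (y_comp (local_cohomology (n - 1) (cyclic_quotient (f_lambda lam ^+ r))) j)
        (- n%:Z - j + r%:Z + 1)].
Proof.
pose q : {mpoly K[n]} := \prod_i 'X_i.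
have qE (lam : 'rV[K]_n) : (q.@[fun i => lam 0 i] != 0) <-> (forall i, lam 0 i != 0).
  rewrite /q rmorph_prod /= (eq_bigr (fun i => lam 0 i)) => [|i _]; last exact: mevalXU.
  by split=> [/prodf_neq0 h i|h]; [apply: h | apply/prodf_neq0 => i _].
exists [set lam | forall i, lam 0 i != 0]; split.
- exists [set q]; apply/seteqP; split=> lam /= h; first by exists q => //; apply/qE.
  by case: h => p -> /qE.
- by exists (const_mx 1) => i /=; rewrite mxE oner_eq0.
move=> lam lam0 j jn; pose d := `|(- n%:Z - j)|%N.
have dE : d%:Z = - n%:Z - j by rewrite /d gez0_abs //; lia.
have -> : j = - n%:Z - d%:Z by lia.
have -> : - n%:Z - (- n%:Z - d%:Z) + r%:Z + 1 = (d.+1 + r)%N%:Z by lia.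
exact: regularity_component.
Qed.
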